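(* Assume conditions (C1) and (C2) stated in the context, with pairwise feedback $K=2$. Then \[ \sup_{p\in\mathcal P}\sup_{T\ge1}\sum_{t=0}^{T-1}\mathbb E_p\big[\mathcal G^{\mathrm{DPO}}_p(\widehat\pi_t)\big]<\infty. \] More precisely, let $\varepsilon_0>0$ be a constant such that $\mathcal G_p(R_q)\in\{0\}\cup[\varepsilon_0,\infty)$ for all $p,q\in\mathcal P$ (such a constant exists), let $\gamma_{\mathcal P,\varepsilon_0}\in(0,\infty)$ be a constant such that for all $p,q\in\mathcal P$, $\mathcal G_p(R_q)\ge\varepsilon_0$ implies $\mathcal L_p(R_q)-\mathcal L_p(R_p)\ge\gamma_{\mathcal P,\varepsilon_0}$ (such a constant exists), and set $\gamma:=\beta^{-2}\gamma_{\mathcal P,\varepsilon_0}$, $N_\gamma:=\mathcal N(\mathcal F_{\mathcal P},\gamma/32,\|\cdot\|_{\infty,\mathrm{supp}(\pi_0)})$, $c_\gamma:=\gamma^2/(128(\log 2+2B_{\mathcal P})^2)$. Then \[ \sup_{p\in\mathcal P}\sup_{T\ge1}\sum_{t=0}^{T-1}\mathbb E_p\big[\mathcal G^{\mathrm{DPO}}_p(\widehat\pi_t)\big]\le\Delta^{\mathcal P}_{\max}\Big(1+\Big\lceil\tfrac1{c_\gamma}\log(2N_\gamma)\Big\rceil+\frac1{e^{c_\gamma}-1}\Big). \]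
   Context: Setting. $\mathcal X$ is a measurable context space with probability distribution $d_0$; $\mathcal A$ is a separable metric space. The reference policy $\pi_0$ is a Markov kernel $\mathcal X\to\Delta(\mathcal A)$; $S_x:=\mathrm{supp}(\pi_0(\cdot\mid x))$ (topological support), $S_{\pi_0}:=\{(x,a):a\in S_x\}$, $\|f\|_{\infty,\mathrm{supp}(\pi_0)}:=\sup_{(x,a)\in S_{\pi_0}}|f(x,a)|$. A reward is a measurable $R:\mathcal X\times\mathcal A\to\mathbb R$, $\pi_0$-centered if $\int R(x,a)\pi_0(da\mid x)=0$ for all $x$. Here $K=2$. For a slate $\mathbf a=(a_1,a_2)$, $\mathbf v_R(x,\mathbf a)=(R(x,a_1),R(x,a_2))$, $P_R(y=k\mid x,\mathbf a)=e^{R(x,a_k)}/(e^{R(x,a_1)}+e^{R(x,a_2)})$, $\ell(\mathbf v,y)=\log(e^{v_1}+e^{v_2})-v_y$. A fixed measurable tie-breaking rule assigns to each reward $R$ a measurable $a_R$ with $a_R(x)\in\arg\max_{a\in S_x}R(x,a)$. Truths: a set $\mathcal P$, each $p$ inducing a $\pi_0$-centered reward $R_p$; $\mathcal F_{\mathcal P}=\{R_p:p\in\mathcal P\}$; $a_p:=a_{R_p}$. (C1) $\mathcal F_{\mathcal P}$ is compact under $\|\cdot\|_{\infty,\mathrm{supp}(\pi_0)}$, and each $R\in\mathcal F_{\mathcal P}$ has $a\mapsto R(x,a)$ continuous on $S_x$ for $d_0$-a.e. $x$. (C2) There is $\Delta^{\mathcal P}_{\min}>0$ with: for every $p$, $d_0$-a.s.,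 $a_p(X)$ is the unique maximizer and $R_p(X,a_p(X))-\sup_{a\in S_X,a\neq a_p(X)}R_p(X,a)\ge\Delta^{\mathcal P}_{\min}$. $\Delta^{\mathcal P}_{\max}:=\sup_p\sup_x\sup_{a\in S_x}(R_p(x,a_p(x))-R_p(x,a))$. $\mathcal G_p(R):=\mathbb E_{X\sim d_0}[R_p(X,a_p(X))-R_p(X,a_R(X))]$; $\mathcal L_p(R):=\mathbb E[\ell(\mathbf v_R(X,\mathbf A),Y)]$ with $X\sim d_0$, $\mathbf A\sim\pi_0(\cdot\mid X)^{\otimes2}$, $Y\sim P_{R_p}(\cdot\mid X,\mathbf A)$. $B_{\mathcal P}:=\sup_{R\in\mathcal F_{\mathcal P}}\|R\|_{\infty,\mathrm{supp}(\pi_0)}$, $\eta>0$, $\beta:=e^{2\eta B_{\mathcal P}}$; $\mathcal N(\mathcal F,\varepsilon,\|\cdot\|)$ is the $\varepsilon$-covering number. KL tilt: $\pi_R(\cdot\mid x)$ has density $e^{\eta R(x,a)}/\int e^{\eta R(x,a')}\pi_0(da'\mid x)$ w.r.t. $\pi_0(\cdot\mid x)$. $\Pi^{\mathrm{DPO}}_{\mathcal P}:=\{\pi_R:R\in\mathcal F_{\mathcal P}\}$. DPO loss: $\widehat{\mathcal L}^{\mathrm{DPO}}_t(\pi):=\frac1t\sum_{s=1}^t-\log\sigma\big(\frac1\eta[\log\frac{d\pi(\cdot\mid x_s)}{d\pi_0(\cdot\mid x_s)}(a_{s,y_s})-\log\frac{d\pi(\cdot\mid x_s)}{d\pi_0(\cdot\mid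 x_s)}(a_{s,3-y_s})]\big)$ with $\sigma(u)=(1+e^{-u})^{-1}$. Online DPO under truth $p$: $\widehat\pi_0=\pi_1=\pi_0$; for $t\ge1$: $x_t\sim d_0$ i.i.d., $a_{t,1},a_{t,2}$ i.i.d. from $\pi_t(\cdot\mid x_t)$, $y_t\sim P_{R_p}(\cdot\mid x_t,\mathbf a_t)$, $\widehat\pi_t\in\arg\min_{\pi\in\Pi^{\mathrm{DPO}}_{\mathcal P}}\widehat{\mathcal L}^{\mathrm{DPO}}_t(\pi)$ (exact minimizer via a fixed measurable selection), $\pi_{t+1}=\widehat\pi_t$. $\mathbb E_p$ refers to this process. Selector of a policy: for $\pi\in\Pi^{\mathrm{DPO}}_{\mathcal P}$, $a_\pi(x):=a_R(x)$ for any $R\in\mathcal F_{\mathcal P}$ with $\pi=\pi_R$ (well defined $d_0$-a.s.); $a_{\pi_0}:=a_0$ where $0$ is the zero reward. $\mathcal G^{\mathrm{DPO}}_p(\pi):=\mathbb E_{X\sim d_0}[R_p(X,a_p(X))-R_p(X,a_\pi(X))]$. *)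

(* Defs.v *)
From mathcomp Require Import all_boot all_algebra.
From mathcomp Require Import all_classical all_reals all_analysis.
From Stdlib Require List.
Unset Strict Implicit.
Unset Printing Implicit Defensive.
Import GRing.Theory Num.Theory.
Import numFieldNormedType.Exports.
Local Open Scope classical_set_scope.
Local Open Scope ring_scope.

(** The action space [A] is a (pointed) pseudometric space; together with
    [hausdorff_space A] it is a metric space.  [Borel A] is the same carrier
    equipped with its Borel sigma-algebra (generated by the open sets). *)
Definition Borel {R : realType} (A : pseudoPMetricType R) :=
  g_sigma_algebraType (@open A).

(** One round of data: context x, slate (a1, a2), feedback y.
    y = true encodes "y = 1" (a1 preferred), y = false encodes "y = 2". *)
Definition step {R : realType} {d : measure_display} (X : measurableType d)
  (A : pseudoPMetricType R) := (X * Borel A * Borel A * bool)%type.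

Definition st_x {R : realType} {d} {X : measurableType d} {A : pseudoPMetricType R}
  (s : step X A) : X := s.1.1.1.
Definition st_a1 {R : realType} {d} {X : measurableType d} {A : pseudoPMetricType R}
  (s : step X A) : A := s.1.1.2.
Definition st_a2 {R : realType} {d} {X : measurableType d} {A : pseudoPMetricType R}
  (s : step X A) : A := s.1.2.
Definition st_y {R : realType} {d} {X : measurableType d} {A : pseudoPMetricType R}
  (s : step X A) : bool := s.2.

(** Sample paths (x_t, a_{t,1}, a_{t,2}, y_t)_{t}, coordinate s = round s+1,
    with the product (cylinder) sigma-algebra. *)
Definition cylinders {R : realType} {d} (X : measurableType d)
  (A : pseudoPMetricType R) : set (set (nat -> step X A)) :=
  [set C | exists n (B : set (step X A)), measurable B /\ C = (fun w => w n) @^-1` B].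

Definition Omega {R : realType} {d} (X : measurableType d) (A : pseudoPMetricType R) :=
  g_sigma_algebraType (cylinders X A).

Section DPO.
Context {R : realType} {d : measure_display} {X : measurableType d}
  {A : pseudoPMetricType R}.
Variables (d0 : probability X R) (pi0 : R.-pker X ~> Borel A).

Definition reward := X -> A -> R.
Definition zero_reward : reward := fun _ _ => 0.

Definition supp (x : X) : set A :=
  [set a | forall U : set A, open U -> U a -> (0 < pi0 x U)%E].

Definition supnorm (f : reward) : \bar R :=
  ereal_sup [set (`|f z.1 z.2|)%:E | z in [set z : X * A | supp z.1 z.2]].

Definition rdiff (f g : reward) : reward := fun x a => f x a - g x a.

Definition sup_open (U : set reward) : Prop :=
  forall f, U f -> exists2 e : R, 0 < e &
    forall g, (supnorm (rdiff g f) < e%:E)%E -> U g.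

Definition sup_compact (K : set reward) : Prop :=
  forall (I : Type) (U : I -> set reward),
    (forall i, sup_open (U i)) -> K `<=` \bigcup_i U i ->
    exists2 J : set I, finite_set J & K `<=` \bigcup_(i in J) U i.

Definition is_cover (K : set reward) (eps : R) (C : seq reward) : Prop :=
  (forall c, List.In c C -> K c) /\
  (forall f, K f -> exists2 c, List.In c C & (supnorm (rdiff f c) <= eps%:E)%E).

Definition covering_number (K : set reward) (eps : R) (N : nat) : Prop :=
  (exists2 C, size C = N & is_cover K eps C) /\
  (forall C, is_cover K eps C -> (N <= size C)%N).

Definition argmax_sel (Rw : reward) (a : X -> A) : Prop :=
  forall x, supp x (a x) /\ forall b, supp x b -> Rw x b <= Rw x (a x).

Definition prefP (Rw : reward) (x : X) (a1 a2 : A) (y : bool) : R :=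
  (if y then expR (Rw x a1) else expR (Rw x a2)) /
  (expR (Rw x a1) + expR (Rw x a2)).

Definition ell (v1 v2 : R) (y : bool) : R :=
  ln (expR v1 + expR v2) - (if y then v1 else v2).

Definition popL (Rtrue Rw : reward) : \bar R :=
  (\int[d0]_x \int[pi0 x]_a1 \int[pi0 x]_a2
     ((prefP Rtrue x a1 a2 true * ell (Rw x a1) (Rw x a2) true
     + prefP Rtrue x a1 a2 false * ell (Rw x a1) (Rw x a2) false)%:E))%E.

(** suboptimality G_p(Rw) w.r.t. a tie-breaking rule sel (a_R = sel R) *)
Definition subopt (sel : reward -> X -> A) (Rtrue Rw : reward) : \bar R :=
  (\int[d0]_x (Rtrue x (sel Rtrue x) - Rtrue x (sel Rw x))%:E)%E.

Variable eta : R.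

Definition tiltZ (Rw : reward) (x : X) : \bar R :=
  (\int[pi0 x]_a (expR (eta * Rw x a))%:E)%E.
Definition tilt_density (Rw : reward) (x : X) (a : A) : R :=
  expR (eta * Rw x a) / fine (tiltZ Rw x).
Definition logratio (Rw : reward) (x : X) (a : A) : R :=
  ln (tilt_density Rw x a).

Definition sigmoid (u : R) : R := (1 + expR (- u))^-1.

Definition dpo_loss (t : nat) (w : nat -> step X A) (Rw : reward) : R :=
  (t%:R)^-1 * \sum_(s < t)
    - ln (sigmoid (eta^-1 *
      (logratio Rw (st_x (w s))
         (if st_y (w s) then st_a1 (w s) else st_a2 (w s))
     - logratio Rw (st_x (w s))
         (if st_y (w s) then st_a2 (w s) else st_a1 (w s))))).

(** The online DPO process under truth Rtrue, with policy iterates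
    pi_{t+1} = pi_{rhat t w} (rhat 0 = zero reward, i.e. pi_1 = pi0).
    Round t+1 (coordinate t of the path) is drawn as
    x ~ d0, a1, a2 iid ~ pi_{rhat t w}(.|x), y ~ P_Rtrue(.|x,a1,a2).
    [Vfrom] integrates out coordinates t, ..., t+k-1 (Ionescu-Tulcea). *)
Variables (Rtrue : reward) (rhat : nat -> Omega X A -> reward).

Definition upd (w : nat -> step X A) (t : nat) (s : step X A) : nat -> step X A :=
  fun n => if n == t then s else w n.

Definition round_int (t : nat) (w : nat -> step X A) (g : step X A -> \bar R)
  : \bar R :=
  (\int[d0]_x \int[pi0 x]_a1 \int[pi0 x]_a2
     ((tilt_density (rhat t w) x a1 * tilt_density (rhat t w) x a2)%:E *
      ((prefP Rtrue x a1 a2 true)%:E * g (x, a1, a2, true)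
     + (prefP Rtrue x a1 a2 false)%:E * g (x, a1, a2, false))))%E.

Fixpoint Vfrom (t k : nat) (f : (nat -> step X A) -> \bar R)
    (w : nat -> step X A) : \bar R :=
  match k with
  | 0 => f w
  | k'.+1 => round_int t w (fun s => Vfrom t.+1 k' f (upd w t s))
  end.

Definition expect (T : nat) (f : (nat -> step X A) -> \bar R) : \bar R :=
  Vfrom 0 T f point.

End DPO.

(* Main.v *)
(** The minimal gap and compactness leave finitely many greedy selectors up to
    null sets, so the regret of an iterate is 0 or at least [eps0], and in the latter
    case its excess logistic loss under [pi0] is at least [gam0].  That excess
    loss is a Kullback-Leibler divergence; it dominates the squared Hellinger
    distance, hence, the rewards being centered, the squared L1 distance of the
    rewards, which is bounded below by compactness when the selectors differ.
    Slates are drawn with density at least [beta^-2] with respect to [pi0], so each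
    round contributes at least [gam = beta^-2 gam0] in conditional mean, whatever
    the past.  The DPO minimizer has nonpositive cumulative excess loss; by a
    union bound over a cover and a Chernoff supermartingale, an iterate of
    positive regret does so with probability at most [N exp(-c t)], and the
    geometric series sums to the claimed constant. *)

(* Two obstacles shape the proof. The later conditional expectations along a path are not shown to
   be measurable, so they are never computed: being nonnegative, they are bounded from above, by
   monotonicity, by bounded measurable functions to which linearity applies. And rewards are
   controlled on supports alone, so each is clipped to [[-B, B]]; this changes no integral, since
   every support carries full [pi0]-mass. Centering serves identification: preferences determine a
   reward only up to a function of the context, and centering fixes that function. As to the
   constants, the loss is 2-Lipschitz, so a cover of radius [gam / 32] costs [gam / 16] per round
   when the minimizer is replaced by a cover element, and allowing for that tolerance once more
   leaves the Chernoff argument ample room. Its parameter [l = gam / (4 * M ^+ 2)], with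
   [M = ln 2 + 2 * B] a bound on the loss, keeps exponents at most 1/4 in absolute value before the
   tolerance is added, where [expR z <= 1 + z + z ^+ 2]. *)
Require Import Defs.
From HB Require Import structures.
From mathcomp Require Import all_boot all_order all_algebra.
From mathcomp Require Import all_classical all_reals all_analysis.
From mathcomp Require Import measurable_realfun ring lra.
From Stdlib Require List.
Import Order.TTheory GRing.Theory Num.Theory.
Import numFieldNormedType.Exports.
Local Open Scope classical_set_scope.
Local Open Scope ring_scope.

(** * Integrals of bounded measurable functions against kernels *)

Section conull_integral.
Context {d : measure_display} {T : measurableType d} {R : realType}.
Variables (mu : {measure set T -> \bar R}) (S : set T).
Hypotheses (mS : measurable S) (S_conull : mu (~` S) = 0%E).
Import HBNNSimple.

(* No measurability of [f] and [g]: simple functions below [f] are cut off outside [S]. *)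
Lemma ge0_le_integral_conull (f g : T -> \bar R) :
  (forall x, 0 <= f x)%E -> (forall x, 0 <= g x)%E ->
  (forall x, S x -> f x <= g x)%E ->
  (\int[mu]_x f x <= \int[mu]_x g x)%E.
Proof.
move=> f0 g0 fg.
rewrite !ge0_integralTE//; apply: ge_ereal_sup => _ [h hf <-].
have hS x : proj_nnsfun h mS x = if x \in S then h x else 0.
  by rewrite -mrestrict.
apply: ereal_sup_ubound; exists (proj_nnsfun h mS).
  move=> x; rewrite hS; case: ifPn => // /set_mem Sx.
  by rewrite (le_trans (hf x))// fg.
rewrite -!integralT_nnsfun.
apply: ge0_ae_eq_integral => //.
- exact/measurable_EFinP.
- exact/measurable_EFinP.
- by move=> x _; rewrite lee_fin.
- by move=> x _; rewrite lee_fin.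
exists (~` S); split => //; first exact: measurableC.
by move=> x neq Sx; apply: neq => _; congr EFin; rewrite hS mem_set.
Qed.

(** The integral is by definition a difference of integrals of nonnegative parts, so two
    inequalities for each part suffice. *)
Lemma eq_integral_conull (f g : T -> \bar R) :
  (forall x, S x -> f x = g x) -> (\int[mu]_x f x = \int[mu]_x g x)%E.
Proof.
move=> fg; rewrite integralE [RHS]integralE; congr (_ - _)%E.
- by apply/eqP; rewrite eq_le; apply/andP; split;
    apply: ge0_le_integral_conull => // x Sx; rewrite !funeposE fg.
- by apply/eqP; rewrite eq_le; apply/andP; split;
    apply: ge0_le_integral_conull => // x Sx; rewrite !funenegE fg.
Qed.

End conull_integral.

Lemma ge0_le_integralT {d} {T : measurableType d} {R : realType}
    (mu : {measure set T -> \bar R}) (f g : T -> \bar R) :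
  (forall x, 0 <= f x)%E -> (forall x, f x <= g x)%E ->
  (\int[mu]_x f x <= \int[mu]_x g x)%E.
Proof.
move=> f0 fg; apply: (@ge0_le_integral_conull _ _ _ _ setT) => //.
- by rewrite setCT measure0.
- by move=> x; exact: le_trans (fg x).
Qed.

Section bounded_measurable.
Context {d : measure_display} {T : measurableType d} {R : realType}.
Implicit Types f g : T -> R.

(** Such functions are integrable for every probability and stable under kernel integration
    ([bmeas_kint]), so iterated integrals raise no integrability question. *)
Definition bmeas f :=
  measurable_fun setT f /\ exists M : R, forall x, `|f x| <= M.

Lemma bmeas_cst (c : R) : bmeas (fun=> c).
Proof. by split; [exact: measurable_cst|exists `|c|]. Qed.

Lemma bmeasD f g : bmeas f -> bmeas g -> bmeas (fun x => f x + g x).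
Proof.
move=> [mf [M fM]] [mg [N gN]]; split; first exact: measurable_funD.
by exists (M + N) => x; rewrite (le_trans (ler_normD _ _))// lerD.
Qed.

Lemma bmeasM f g : bmeas f -> bmeas g -> bmeas (fun x => f x * g x).
Proof.
move=> [mf [M fM]] [mg [N gN]]; split; first exact: measurable_funM.
by exists (M * N) => x; rewrite normrM ler_pM.
Qed.

Lemma bmeasZ (c : R) f : bmeas f -> bmeas (fun x => c * f x).
Proof. by move=> bf; apply: bmeasM => //; exact: bmeas_cst. Qed.

Lemma bmeasN f : bmeas f -> bmeas (fun x => - f x).
Proof.
move=> [mf [M fM]]; split; first exact: measurableT_comp.
by exists M => x; rewrite normrN.
Qed.

Lemma bmeasB f g : bmeas f -> bmeas g -> bmeas (fun x => f x - g x).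
Proof. by move=> bf bg; apply: bmeasD => //; exact: bmeasN. Qed.

Lemma bmeas_norm f : bmeas f -> bmeas (fun x => `|f x|).
Proof.
move=> [mf [M fM]]; split; first exact: measurableT_comp.
by exists M => x; rewrite normr_id.
Qed.

Lemma bmeas_clip (a b : R) f : measurable_fun setT f -> a <= b ->
  bmeas (fun x => Num.max a (Num.min b (f x))).
Proof.
move=> mf ab; split.
  by apply: measurable_maxr => //; exact: measurable_minr.
exists (`|a| + `|b|) => x; set y := Num.max _ _.
have : a <= y <= b.
  by rewrite /y le_max lexx /= ge_max ab ge_min lexx.
move=> /andP[ay yb]; have := ler_norm b; have := ler_norm (- a).
have := normr_ge0 a; have := normr_ge0 b.
by rewrite normrN ler_norml => ? ? ? ?; apply/andP; split; lra.
Qed.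

Lemma bmeas_comp_cont (phi : R -> R) f :
  measurable_fun setT phi -> (forall M, exists N, forall x, `|x| <= M -> `|phi x| <= N) ->
  bmeas f -> bmeas (fun x => phi (f x)).
Proof.
move=> mphi bphi [mf [M fM]]; split; first exact: measurableT_comp.
by have [N HN] := bphi M; exists N => x; exact: HN.
Qed.

Lemma bmeas_expR f : bmeas f -> bmeas (fun x => expR (f x)).
Proof.
apply: bmeas_comp_cont; first exact: measurable_expR.
move=> M; exists (expR M) => x /ler_normlW xM.
by rewrite ger0_norm ?expR_ge0// ler_expR.
Qed.

End bounded_measurable.

Lemma bmeas_comp {d d'} {T : measurableType d} {U : measurableType d'}
    {R : realType} (phi : T -> U) (f : U -> R) :
  measurable_fun setT phi -> bmeas f -> bmeas (fun x => f (phi x)).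
Proof.
by move=> mphi [mf [M fM]]; split; [exact: measurableT_comp|exists M].
Qed.

Section kernel_integral.
Context {d d' : measure_display} {Y : measurableType d} {Z : measurableType d'}
  {R : realType}.
Variable k : R.-pker Y ~> Z.
Implicit Types f g : Y * Z -> R.

Lemma bmeas_integrable (y : Y) (f : Z -> R) :
  bmeas f -> (k y).-integrable setT (EFin \o f).
Proof.
move=> [mf [M fM]]; apply: measurable_bounded_integrable => //.
  by rewrite prob_kernel ltry.
exists M; split; first exact: num_real.
by move=> N MN x _ /=; rewrite (le_trans (fM x))// ltW.
Qed.

Definition kint f (y : Y) : R := \int[k y]_z f (y, z).

Lemma bmeas_section f y : bmeas f -> bmeas (fun z => f (y, z)).
Proof. by move=> bf; apply: (bmeas_comp (pair y)) => //; exact: pair1_measurable. Qed.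

Lemma kintE f y : bmeas f -> (\int[k y]_z (f (y, z))%:E = (kint f y)%:E)%E.
Proof.
move=> bf; rewrite /kint /Rintegral fineK//.
by apply: integrable_fin_num => //; apply: bmeas_integrable; exact: bmeas_section.
Qed.

Lemma kint_le f g y : bmeas f -> bmeas g ->
  (forall z, f (y, z) <= g (y, z)) -> kint f y <= kint g y.
Proof.
move=> bf bg fg; apply: le_Rintegral => //;
  by apply: bmeas_integrable; exact: bmeas_section.
Qed.

Lemma kint_cst_section (c : R) f y : (forall z, f (y, z) = c) -> kint f y = c.
Proof.
move=> fc; rewrite /kint (_ : (fun z => _) = cst c); last exact/funext.
by rewrite Rintegral_cst// prob_kernel /= mulr1.
Qed.

Lemma kintD f g y : bmeas f -> bmeas g ->
  kint (fun z => f z + g z) y = kint f y + kint g y.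
Proof.
by move=> bf bg; apply: RintegralD => //; apply: bmeas_integrable; exact: bmeas_section.
Qed.

Lemma kintZ (c : R) f y : bmeas f -> kint (fun z => c * f z) y = c * kint f y.
Proof.
by move=> bf; apply: RintegralZl => //; apply: bmeas_integrable; exact: bmeas_section.
Qed.

Lemma bmeas_kint f : bmeas f -> bmeas (kint f).
Proof.
move=> bf; have [mf [M fM]] := bf.
have bM : bmeas (fun=> M : R) := bmeas_cst M.
split; last first.
  exists M => y; rewrite ler_norml; apply/andP; split.
    rewrite -(@kint_cst_section (- M) (fun=> - M) y)//.
    apply: kint_le => //; first exact: bmeas_cst.
    by move=> z; have /ler_normlP[] := fM (y, z); lra.
  rewrite -(@kint_cst_section M (fun=> M) y)//.
  by apply: kint_le => // z; exact: ler_normlW.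
(* [measurable_fun_integral_finite_kernel] takes a nonnegative integrand, hence the shift by the
   bound [M]. *)
have -> : kint f = (fun y => kint (fun z => f z + M) y - M).
  by apply/funext => y; rewrite kintD// (@kint_cst_section M (fun=> M))// addrK.
apply: measurable_funB => //.
have bfM : bmeas (fun z => f z + M) by exact: bmeasD.
apply/measurable_EFinP.
have -> : EFin \o (kint (fun z => f z + M)) =
    (fun y => \int[k y]_z (f (y, z) + M)%:E)%E.
  by apply/funext => y /=; rewrite -(kintE _ y bfM).
apply: (measurable_fun_integral_finite_kernel (fun z => (f z + M)%:E)).
  by move=> z; rewrite lee_fin; have /ler_normlP[] := fM z; lra.
by apply/measurable_EFinP; have [] := bfM.
Qed.

End kernel_integral.

Section kernel_fst.
Context {d d' d'' : measure_display} {Y : measurableType d}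
  {Z : measurableType d'} {W : measurableType d''} {R : realType}.
Variable k : R.-pker Y ~> Z.

(** Draws the second action given the context and the first action, ignoring the latter, so that
    [kint] serves for both arms. *)
Definition kernel_fst : Y * W -> {measure set Z -> \bar R} := fun y => k y.1.

Let measurable_kernel_fst U : measurable U ->
  measurable_fun [set: Y * W] (kernel_fst ^~ U).
Proof.
by move=> mU; apply: (measurableT_comp (measurable_kernel k U mU)).
Qed.

HB.instance Definition _ :=
  @isKernel.Build _ _ _ _ _ kernel_fst measurable_kernel_fst.

Let kernel_fst_setT y : kernel_fst y setT = 1%E.
Proof. by rewrite /kernel_fst prob_kernel. Qed.

HB.instance Definition _ :=
  @Kernel_isProbability.Build _ _ _ _ _ kernel_fst kernel_fst_setT.

End kernel_fst.

(** * Topological supports and slate integrals *)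

Section support.
Context {R : realType} {d : measure_display} {X : measurableType d}
  {A : pseudoPMetricType R}.
Variable pi0 : R.-pker X ~> Borel A.

Lemma borel_open (U : set A) : open U -> measurable (U : set (Borel A)).
Proof. exact: sub_sigma_algebra. Qed.

Lemma open_supp_compl x : open (~` supp pi0 x).
Proof.
rewrite (_ : ~` _ = \bigcup_(U in [set U : set A | open U /\ pi0 x U = 0%E]) U).
  by apply: bigcup_open => U [].
apply/seteqP; split => [a /existsNP[U /not_implyP[oU /not_implyP[Ua]]]|a [U [oU U0] Ua]].
  move/negP; rewrite -leNgt => U0; exists U => //; split => //.
  by apply/eqP; rewrite eq_le U0 measure_ge0.
by move/(_ U oU Ua); rewrite U0 ltxx.
Qed.

Lemma measurable_supp x : measurable (supp pi0 x : set (Borel A)).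
Proof.
rewrite -(setCK (supp pi0 x)); apply: measurableC.
exact: borel_open (open_supp_compl x).
Qed.

Hypothesis A_separable : exists2 D : set A, countable D & closure D = setT.

(** The complement is a union of null open sets, possibly uncountable. Separability replaces it by
    countably many: the null ones among the balls of radius [m.+1%:R^-1] around dense points already
    cover it. *)
Lemma supp_conull x : pi0 x (~` supp pi0 x) = 0%E.
Proof.
have [D cD dD] := A_separable.
have mS : measurable (~` supp pi0 x : set (Borel A)).
  exact: measurableC (measurable_supp x).
apply/(negligibleP _ mS).
have [D0|[f]] := pfcard_geP cD.
  by have : [set: A] point by []; rewrite -dD D0 closure0.
pose V n m : set (Borel A) := (ball (f n) m.+1%:R^-1)°.
pose W n m := if pi0 x (V n m) == 0%E then V n m else set0.
apply: (@negligibleS _ _ _ _ (\bigcup_n \bigcup_m W n m)); last first.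
  apply: negligible_bigcup => n; apply: negligible_bigcup => m.
  rewrite /W; case: ifPn => [/eqP V0|_]; last exact: negligible_set0.
  by apply/negligibleP => //; apply: borel_open; exact: open_interior.
move=> a /existsNP[U /not_implyP[oU /not_implyP[Ua /negP]]].
rewrite -leNgt => U0.
have /nbhs_ballP[e /= e0 eU] : nbhs a U by exact: open_nbhs_nbhs.
have [m me] : exists m, (m.+1%:R^-1 : R) < e / 2.
  have : 0 < e / 2 by rewrite divr_gt0.
  by move=> /ltr_add_invr[m]; rewrite add0r => ?; exists m.
have h0 : 0 < (m.+1%:R^-1 / 2 : R) by rewrite divr_gt0.
have : closure D a by rewrite dD.
move=> /(_ (ball a (m.+1%:R^-1 / 2)))[|b [Db ab]].
  exact: nbhsx_ballx.
have [n _ fb] := @surj _ _ _ _ f _ Db.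
have VU : V n m `<=` U.
  move=> c /interior_subset; rewrite fb => bc; apply: eU.
  apply: (@le_ball _ _ _ (e / 2 + e / 2)); first by rewrite -splitr.
  apply: (@ball_triangle _ _ b).
    by apply: le_ball ab; rewrite ltW// (le_lt_trans _ me)// ler_pdivrMr// ler_peMr ?ler1n// invr_ge0.
  by apply: le_ball bc; exact: ltW.
exists n => //; exists m => //; rewrite /W ifT; last first.
  rewrite eq_le measure_ge0 andbT (le_trans _ U0)// le_measure ?inE//.
  - by apply: borel_open; exact: open_interior.
  - exact: borel_open.
rewrite /V fb; apply/nbhs_ballP; exists (m.+1%:R^-1 / 2) => //= c ac.
rewrite [m.+1%:R^-1]splitr; apply: (@ball_triangle _ _ a) => //.
exact: ball_sym.
Qed.

Lemma supp_nonempty x : exists a, supp pi0 x a.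
Proof.
apply: contrapT => /forallNP S0.
have := supp_conull x; rewrite (_ : ~` _ = setT).
  by rewrite prob_kernel => -[] /eqP; rewrite oner_eq0.
by apply/seteqP; split => // a _; exact: S0.
Qed.

Variable d0 : probability X R.
Notation slate := (X * Borel A * Borel A)%type.
Implicit Types f g : slate -> R.

(* Locked: unfolding the nested integrals makes conversion tests explode. *)
Definition slate_int f : R :=
  locked (\int[d0]_x kint pi0 (kint (kernel_fst (W := Borel A) pi0) f) x).

Lemma slate_int_unlock f : slate_int f =
  \int[d0]_x kint pi0 (kint (kernel_fst (W := Borel A) pi0) f) x.
Proof. by rewrite /slate_int -lock. Qed.

(** [f] may exceed [g] off [S]; replacing it by [Num.min f g] keeps the integral and makes the
    comparison pointwise. *)
Lemma kint_le_supp {d'} {Y : measurableType d'} (k : R.-pker Y ~> Borel A)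
    (S : set (Borel A)) (f g : Y * Borel A -> R) y :
  measurable S -> k y (~` S) = 0%E -> bmeas f -> bmeas g ->
  (forall z, S z -> f (y, z) <= g (y, z)) -> kint k f y <= kint k g y.
Proof.
move=> mS S0 bf bg fg.
have bm : bmeas (fun z => Num.min (f z) (g z)).
  case: bf bg => [mf [M fM]] [mg [N gN]]; split; first exact: measurable_minr.
  exists (M + N) => z; have := fM z; have := gN z.
  have := normr_ge0 (f z); have := normr_ge0 (g z).
  by rewrite minEle; case: ifP => _; lra.
have -> : kint k f y = kint k (fun z => Num.min (f z) (g z)) y.
  congr fine; apply: (eq_integral_conull _ _ mS S0) => z Sz.
  by congr EFin; apply/esym/min_idPl/fg.
by apply: kint_le => // z; rewrite ge_min lexx orbT.
Qed.

Lemma bmeas_slate_inner f : bmeas f ->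
  bmeas (kint pi0 (kint (kernel_fst (W := Borel A) pi0) f)).
Proof. by move=> bf; do 2 apply: bmeas_kint. Qed.

Lemma probability_bmeas_integrable (h : X -> R) :
  bmeas h -> d0.-integrable setT (EFin \o h).
Proof.
move=> [mf [M fM]]; apply: measurable_bounded_integrable => //.
  by rewrite [X in (X < _)%E]probability_setT ltry.
exists M; split; first exact: num_real.
by move=> N MN x _ /=; rewrite (le_trans (fM x))// ltW.
Qed.

Lemma slate_int_le f g : bmeas f -> bmeas g ->
  (forall x a1 a2, supp pi0 x a1 -> supp pi0 x a2 ->
     f (x, a1, a2) <= g (x, a1, a2)) ->
  slate_int f <= slate_int g.
Proof.
move=> bf bg fg; rewrite !slate_int_unlock; apply: le_Rintegral => //.
- by apply: probability_bmeas_integrable; exact: bmeas_slate_inner.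
- by apply: probability_bmeas_integrable; exact: bmeas_slate_inner.
move=> x _; apply: (kint_le_supp pi0 _ _ _ x (measurable_supp x) (supp_conull x)).
- exact: bmeas_kint.
- exact: bmeas_kint.
move=> a1 s1.
apply: (kint_le_supp (kernel_fst pi0) _ _ _ (x, a1) (measurable_supp x)
  (supp_conull x)) => // a2 s2.
exact: fg.
Qed.

Lemma slate_int_cst (c : R) : slate_int (fun=> c) = c.
Proof.
rewrite slate_int_unlock (_ : (fun x => _) = cst c).
  by rewrite Rintegral_cst// [X in fine X]probability_setT /= mulr1.
apply/funext => x; apply: kint_cst_section => a1.
exact: kint_cst_section.
Qed.

Lemma slate_intD f g : bmeas f -> bmeas g ->
  slate_int (fun z => f z + g z) = slate_int f + slate_int g.
Proof.
move=> bf bg; rewrite !slate_int_unlock -RintegralD//; first last.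
- by apply: probability_bmeas_integrable; exact: bmeas_slate_inner.
- by apply: probability_bmeas_integrable; exact: bmeas_slate_inner.
congr (Rintegral _ _ _); apply/funext => x.
rewrite -kintD; [|exact: bmeas_kint..].
by congr (kint _ _ _); apply/funext => y; rewrite -kintD.
Qed.

Lemma slate_intZ (c : R) f : bmeas f ->
  slate_int (fun z => c * f z) = c * slate_int f.
Proof.
move=> bf; rewrite !slate_int_unlock -RintegralZl//; last first.
  by apply: probability_bmeas_integrable; exact: bmeas_slate_inner.
congr (Rintegral _ _ _); apply/funext => x.
rewrite -kintZ; last exact: bmeas_kint.
by congr (kint _ _ _); apply/funext => y; rewrite -kintZ.
Qed.

Lemma slate_intB f g : bmeas f -> bmeas g ->
  slate_int (fun z => f z - g z) = slate_int f - slate_int g.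
Proof.
move=> bf bg; have -> : (fun z => f z - g z) = (fun z => f z + -1 * g z).
  by apply/funext => z; rewrite mulN1r.
rewrite slate_intD//; last exact: bmeasZ.
by rewrite slate_intZ// mulN1r.
Qed.

Lemma bmeas_sum {d'} {T : measurableType d'} (I : Type) (s : seq I)
    (F : I -> T -> R) :
  (forall i, bmeas (F i)) -> bmeas (fun z => \sum_(i <- s) F i z).
Proof.
move=> bF; elim: s => [|i s IH].
  rewrite (_ : (fun z => _) = fun=> 0); first exact: bmeas_cst.
  by apply/funext => z; rewrite big_nil.
rewrite (_ : (fun z => _) = fun z => F i z + \sum_(i <- s) F i z).
  exact: bmeasD.
by apply/funext => z; rewrite big_cons.
Qed.

Lemma slate_int_sum (I : Type) (s : seq I) (F : I -> slate -> R) :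
  (forall i, bmeas (F i)) ->
  slate_int (fun z => \sum_(i <- s) F i z) = \sum_(i <- s) slate_int (F i).
Proof.
move=> bF; elim: s => [|i s IH].
  rewrite big_nil -[RHS](slate_int_cst 0); congr slate_int.
  by apply/funext => z; rewrite big_nil.
rewrite big_cons -IH -slate_intD; [|exact: bF|exact: bmeas_sum].
by congr slate_int; apply/funext => z; rewrite big_cons.
Qed.

(** Entry point for the extended iterated integrals of the definitions: [F] is unclipped, [f] its
    clipped version. *)
Lemma slate_intE (F : X -> A -> A -> \bar R) f : bmeas f ->
  (forall x a1 a2, supp pi0 x a1 -> supp pi0 x a2 ->
     F x a1 a2 = (f (x, a1, a2))%:E) ->
  (\int[d0]_x \int[pi0 x]_a1 \int[pi0 x]_a2 F x a1 a2 = (slate_int f)%:E)%E.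
Proof.
move=> bf Ff; rewrite slate_int_unlock /Rintegral fineK; last first.
  apply: integrable_fin_num => //.
  by apply: probability_bmeas_integrable; exact: bmeas_slate_inner.
apply: eq_integral => x _; rewrite -kintE; last exact: bmeas_kint.
apply: (eq_integral_conull _ _ (measurable_supp x) (supp_conull x)) => a1 s1.
rewrite -kintE//.
apply: (eq_integral_conull _ _ (measurable_supp x) (supp_conull x)) => a2 s2.
exact: Ff.
Qed.

(** One-sided form of [slate_intE] for an [F] that contains the expectation of later rounds. *)
Lemma slate_int_ge (F : X -> A -> A -> \bar R) f : bmeas f ->
  (forall x a1 a2, 0 <= F x a1 a2)%E -> (forall z, 0 <= f z) ->
  (forall x a1 a2, supp pi0 x a1 -> supp pi0 x a2 ->
     F x a1 a2 <= (f (x, a1, a2))%:E)%E ->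
  (\int[d0]_x \int[pi0 x]_a1 \int[pi0 x]_a2 F x a1 a2 <= (slate_int f)%:E)%E.
Proof.
move=> bf F0 f0 Ff.
rewrite -(slate_intE (fun x a1 a2 => (f (x, a1, a2))%:E) f bf); last by [].
apply: ge0_le_integralT => x; first by do 2 apply: integral_ge0 => ? _.
apply: (ge0_le_integral_conull _ _ (measurable_supp x) (supp_conull x)).
- by move=> a1; apply: integral_ge0 => ? _.
- by move=> a1; apply: integral_ge0 => ? _; rewrite lee_fin.
move=> a1 s1.
apply: (ge0_le_integral_conull _ _ (measurable_supp x) (supp_conull x)) => //.
- by move=> a2; rewrite lee_fin.
- by move=> a2 s2; exact: Ff.
Qed.

End support.

(** * Logistic loss and preference probabilities *)

Section logistic.
Context {R : realType}.
Implicit Types (u v w p q b r x z : R) (y : bool).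

Definition pref v1 v2 y : R :=
  (if y then expR v1 else expR v2) / (expR v1 + expR v2).

(* [kl u1 u2 v1 v2] is the Kullback-Leibler divergence between the preference
   laws with logits [u] and [v], written as an excess logistic loss. *)
Definition kl u1 u2 v1 v2 : R :=
  pref u1 u2 true * (ell v1 v2 true - ell u1 u2 true)
  + pref u1 u2 false * (ell v1 v2 false - ell u1 u2 false).

Lemma addr_expR_gt0 v1 v2 : 0 < expR v1 + expR v2.
Proof. by rewrite addr_gt0// expR_gt0. Qed.

Lemma pref_gt0 v1 v2 y : 0 < pref v1 v2 y.
Proof. by rewrite divr_gt0 ?addr_expR_gt0//; case: y; rewrite expR_gt0. Qed.

Lemma pref_sum v1 v2 : pref v1 v2 true + pref v1 v2 false = 1.
Proof. by rewrite /pref -mulrDl divff// gt_eqF// addr_expR_gt0. Qed.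

Lemma pref_le1 v1 v2 y : pref v1 v2 y <= 1.
Proof.
have := pref_sum v1 v2; have := pref_gt0 v1 v2 true.
by have := pref_gt0 v1 v2 false; case: y; lra.
Qed.

Lemma ell_ln_pref v1 v2 y : ell v1 v2 y = - ln (pref v1 v2 y).
Proof.
have h := addr_expR_gt0 v1 v2.
rewrite /ell /pref ln_div ?posrE//; last by case: y; rewrite expR_gt0.
by rewrite opprB; case: y; rewrite expRK.
Qed.

Lemma ell_sigmoid v1 v2 y :
  - ln (sigmoid ((if y then v1 else v2) - (if y then v2 else v1))) = ell v1 v2 y.
Proof.
rewrite ell_ln_pref; congr (- ln _); rewrite /sigmoid /pref opprB.
have e1 := expR_gt0 v1; have e2 := expR_gt0 v2.
by case: y; rewrite expRB; field; rewrite ?gt_eqF// ?addr_gt0.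
Qed.

Lemma ell_ge0 v1 v2 y : 0 <= ell v1 v2 y.
Proof. by rewrite ell_ln_pref oppr_ge0 ln_le0// pref_le1. Qed.

Lemma ell_le b v1 v2 y : `|v1| <= b -> `|v2| <= b -> ell v1 v2 y <= ln 2 + 2 * b.
Proof.
move=> /ler_normlP[h1 h2] /ler_normlP[h3 h4]; rewrite /ell.
have : ln (expR v1 + expR v2) <= ln (2 * expR b).
  rewrite ler_ln ?posrE ?addr_expR_gt0 ?mulr_gt0 ?expR_gt0//.
  by rewrite mulr_natl mulr2n lerD// ler_expR.
rewrite lnM ?posrE ?expR_gt0// expRK.
by case: y; lra.
Qed.

Lemma ln_addr_expR_le r v1 v2 w1 w2 : v1 <= w1 + r -> v2 <= w2 + r ->
  ln (expR v1 + expR v2) <= ln (expR w1 + expR w2) + r.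
Proof.
move=> h1 h2; rewrite -[r]expRK -lnM ?posrE ?expR_gt0 ?addr_expR_gt0//.
rewrite ler_ln ?posrE ?mulr_gt0 ?expR_gt0 ?addr_expR_gt0//.
by rewrite mulrDl -!expRD lerD// ler_expR.
Qed.

(** One [r] comes from the log-sum-exp, the other from the linear term. *)
Lemma ell_lipschitz r v1 v2 w1 w2 y : `|v1 - w1| <= r -> `|v2 - w2| <= r ->
  `|ell v1 v2 y - ell w1 w2 y| <= 2 * r.
Proof.
move=> /ler_normlP[h1 h2] /ler_normlP[h3 h4].
have := @ln_addr_expR_le r v1 v2 w1 w2; have := @ln_addr_expR_le r w1 w2 v1 v2.
rewrite /ell ler_norml => H1 H2.
have {}H1 : ln (expR w1 + expR w2) <= ln (expR v1 + expR v2) + r by apply: H1; lra.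
have {}H2 : ln (expR v1 + expR v2) <= ln (expR w1 + expR w2) + r by apply: H2; lra.
by apply/andP; split; case: y; lra.
Qed.

Lemma expR_sub_ge b x z : - b <= x -> - b <= z ->
  expR (- b) * `|x - z| <= `|expR x - expR z|.
Proof.
wlog zx : x z / z <= x.
  move=> H hx hz; have [/H|xz] := leP z x; first exact.
  by rewrite distrC [leRHS]distrC; apply: H => //; exact: ltW.
move=> hx hz; rewrite !ger0_norm ?subr_ge0 ?ler_expR//.
have -> : expR x = expR z * expR (x - z) by rewrite -expRD addrC subrK.
have := expR_ge1Dx (x - z); have : expR (- b) <= expR z by rewrite ler_expR.
have := expR_gt0 z; nra.
Qed.

Lemma pref_sub_ge b u1 u2 v1 v2 :
  `|u1| <= b -> `|u2| <= b -> `|v1| <= b -> `|v2| <= b ->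
  expR (- (4 * b)) / 4 * `|(u1 - u2) - (v1 - v2)|
    <= `|pref u1 u2 true - pref v1 v2 true|.
Proof.
move=> hu1 hu2 hv1 hv2.
(* In this form the numerator is a difference of exponentials with exponents at least [- 2 * b] and
   the denominator is at most [4 * expR (2 * b)]. *)
have -> : pref u1 u2 true - pref v1 v2 true =
    (expR (u1 + v2) - expR (v1 + u2)) /
    ((expR u1 + expR u2) * (expR v1 + expR v2)).
  rewrite /pref !expRD; field.
  by rewrite ?gt_eqF ?addr_gt0 ?expR_gt0.
have -> : u1 - u2 - (v1 - v2) = (u1 + v2) - (v1 + u2) by ring.
set D := (expR u1 + expR u2) * (expR v1 + expR v2).
have D0 : 0 < D by rewrite mulr_gt0// addr_expR_gt0.
have h2 w1 w2 : `|w1| <= b -> `|w2| <= b -> expR w1 + expR w2 <= 2 * expR b.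
  by move=> *; rewrite mulr_natl mulr2n lerD// ler_expR ler_normlW.
have D4 : D <= 4 * expR (2 * b).
  have -> : 4 * expR (2 * b) = (2 * expR b) * (2 * expR b).
    have -> : 2 * b = b + b by ring.
    by rewrite expRD; ring.
  by apply: ler_pM; rewrite ?h2// ltW// addr_expR_gt0.
rewrite normrM normfV (gtr0_norm D0) ler_pdivlMr//.
have H : expR (- (2 * b)) * `|u1 + v2 - (v1 + u2)| <=
    `|expR (u1 + v2) - expR (v1 + u2)|.
  move: hu1 hu2 hv1 hv2 => /ler_normlP[? ?] /ler_normlP[? ?] /ler_normlP[? ?] /ler_normlP[? ?].
  by apply: expR_sub_ge; lra.
apply: le_trans H; rewrite mulrAC ler_wpM2r//.
have -> : expR (- (2 * b)) = expR (- (4 * b)) / 4 * (4 * expR (2 * b)).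
  by rewrite mulrA divfK// -expRD; congr expR; ring.
by rewrite ler_wpM2l// divr_ge0// expR_ge0.
Qed.

(* Hellinger bound: [- ln x >= 1 - x] applied to [x = sqrt (q / p)]. *)
Lemma hellinger_le p q : 0 < p -> 0 < q ->
  2 * p - 2 * (Num.sqrt p * Num.sqrt q) <= p * (ln p - ln q).
Proof.
move=> p0 q0; set s := Num.sqrt p; set t := Num.sqrt q.
have s0 : 0 < s by rewrite sqrtr_gt0.
have t0 : 0 < t by rewrite sqrtr_gt0.
have -> : p = s ^+ 2 by rewrite sqr_sqrtr// ltW.
have -> : q = t ^+ 2 by rewrite sqr_sqrtr// ltW.
rewrite !lnXn//.
have h : ln t - ln s <= t / s - 1.
  rewrite -ln_div ?posrE// -[X in ln X](subrK 1) addrC.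
  by apply: le_ln1Dx; rewrite ltrBDr addrC subrr divr_gt0.
have -> : s ^+ 2 * (ln s *+ 2 - ln t *+ 2) = - (2 * s ^+ 2 * (ln t - ln s)).
  by rewrite !mulr2n; ring.
rewrite lerNr; apply: (@le_trans _ _ (2 * s ^+ 2 * (t / s - 1))).
  by rewrite ler_wpM2l// mulr_ge0// sqr_ge0.
rewrite le_eqVlt; apply/orP; left; apply/eqP; field.
by rewrite gt_eqF.
Qed.

(** The constant is a quarter of the square of the one in [pref_sub_ge]. The quarter is lost in
    bounding [(p - q) ^+ 2] by the squared Hellinger distance, as the two square roots add up to at
    most 2. *)
Lemma kl_ge b u1 u2 v1 v2 :
  `|u1| <= b -> `|u2| <= b -> `|v1| <= b -> `|v2| <= b ->
  expR (- (8 * b)) / 64 * ((u1 - u2) - (v1 - v2)) ^+ 2 <= kl u1 u2 v1 v2.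
Proof.
move=> hu1 hu2 hv1 hv2.
set p := pref u1 u2 true; set q := pref v1 v2 true.
have p0 : 0 < p := pref_gt0 _ _ _; have q0 : 0 < q := pref_gt0 _ _ _.
have p1 : p <= 1 := pref_le1 _ _ _; have q1 : q <= 1 := pref_le1 _ _ _.
apply: (@le_trans _ _ ((p - q) ^+ 2 / 4)).
  have := pref_sub_ge _ _ _ _ _ hu1 hu2 hv1 hv2; rewrite -/p -/q => H.
  rewrite -[X in X / 4]real_normK ?num_real//.
  rewrite -(real_normK (num_real (u1 - u2 - _))).
  have -> : expR (- (8 * b)) = expR (- (4 * b)) ^+ 2.
    by rewrite -expRM_natl; congr expR; ring.
  have : 0 <= expR (- (4 * b)) / 4 * `|u1 - u2 - (v1 - v2)|.
    by rewrite mulr_ge0// divr_ge0// expR_ge0.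
  move: H; set E := expR _; set N := `|_ - _ - _|; set M := `|p - q|; nra.
rewrite /kl !ell_ln_pref -/p -/q.
have pf : pref u1 u2 false = 1 - p by have := pref_sum u1 u2; rewrite -/p; lra.
have qf : pref v1 v2 false = 1 - q by have := pref_sum v1 v2; rewrite -/q; lra.
have p'0 : 0 < 1 - p by rewrite -pf pref_gt0.
have q'0 : 0 < 1 - q by rewrite -qf pref_gt0.
rewrite pf qf.
rewrite !opprK ![- ln _ + _]addrC.
have := hellinger_le _ _ p0 q0; have := hellinger_le _ _ p'0 q'0.
have sq x : 0 < x -> Num.sqrt x ^+ 2 = x by move=> x0; rewrite sqr_sqrtr// ltW.
have := sq _ p0; have := sq _ q0; have := sq _ p'0; have := sq _ q'0.
have sp : 0 <= Num.sqrt p <= 1.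
  by rewrite sqrtr_ge0 -[leRHS]sqrtr1 ler_wsqrtr.
have sq' : 0 <= Num.sqrt q <= 1.
  by rewrite sqrtr_ge0 -[leRHS]sqrtr1 ler_wsqrtr.
move: sp sq'; move: (Num.sqrt p) (Num.sqrt q) (Num.sqrt (1 - p)) (Num.sqrt (1 - q)).
move=> s t s' t' /andP[s0 s1] /andP[t0 t1] et' es' et es H1 H2.
apply: le_trans (lerD H2 H1).
have -> : 2 * p - 2 * (s * t) + (2 * (1 - p) - 2 * (s' * t')) =
    (s - t) ^+ 2 + (s' - t') ^+ 2.
  rewrite !sqrrB es et es' et'; ring.
have -> : (p - q) = (s - t) * (s + t) by rewrite -es -et; ring.
apply: (@le_trans _ _ ((s - t) ^+ 2)); last by rewrite lerDl sqr_ge0.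
rewrite exprMn ler_pdivrMr// ler_wpM2l ?sqr_ge0//.
have : s + t <= 2 by lra.
have : 0 <= s + t by lra.
nra.
Qed.

Lemma kl_ge0 b u1 u2 v1 v2 :
  `|u1| <= b -> `|u2| <= b -> `|v1| <= b -> `|v2| <= b -> 0 <= kl u1 u2 v1 v2.
Proof.
move=> *; apply: le_trans (kl_ge b _ _ _ _ _ _ _ _) => //.
by rewrite mulr_ge0 ?sqr_ge0// divr_ge0// expR_ge0.
Qed.

Lemma expR_le_quadratic z : `|z| <= 4^-1 -> expR z <= 1 + z + z ^+ 2.
Proof.
move=> /ler_normlP[h1 h2].
have inv x : x < 1 -> expR x * (1 - x) <= 1.
  move=> x1; have := expR_ge1Dx (- x); rewrite expRN => H.
  by rewrite mulrC -ler_pdivlMr ?expR_gt0// div1r.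
have [z0|z0] := leP z 0.
  have := inv z; have := expR_gt0 z; set e := expR z => e0 H.
  have {}H : e * (1 - z) <= 1 by apply: H; lra.
  have : 1 <= (1 + z + z ^+ 2) * (1 - z) by have := sqr_ge0 z; nra.
  nra.
(* For positive [z] the bound [1 / (1 - z)] is too weak, since [(1 + z + z ^+ 2) * (1 - z) < 1]; it
   is applied at [z / 2] and squared. *)
have := inv (z / 2); have := expR_gt0 (z / 2); rewrite [X in _ -> _ -> expR X <= _]splitr expRD.
set e := expR (z / 2) => e0 H.
have {}H : e * (1 - z / 2) <= 1 by apply: H; lra.
have w0 : 0 < 1 - z / 2 by lra.
have : (e * (1 - z / 2)) ^+ 2 <= 1.
  by apply: exprn_ile1 => //; rewrite mulr_ge0 ?ltW.
have : 1 <= (1 + z + z ^+ 2) * (1 - z / 2) ^+ 2.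
  have -> : (1 + z + z ^+ 2) * (1 - z / 2) ^+ 2 = 1 + z ^+ 2 * (1 - 3 * z + z ^+ 2) / 4.
    by field.
  have : 0 <= 1 - 3 * z + z ^+ 2 by have := sqr_ge0 z; lra.
  have := sqr_ge0 z; nra.
move=> H1 H2; rewrite -(@ler_pM2r _ ((1 - z / 2) ^+ 2)) ?exprn_gt0//.
by rewrite -expr2 -exprMn (le_trans H2).
Qed.

(** The first [m.+1] terms are bounded by 1. Beyond them [expR (c * m)] absorbs the factor [2 * N],
    and a geometric series starting at [expR (- c)] remains. *)
Lemma sum_min1_geometric_le (T N m : nat) (c : R) : 0 < c ->
  2 * N%:R <= expR (c * m%:R) ->
  \sum_(t < T) Num.min 1 (2 * N%:R * expR (- (c * t%:R)))
    <= 1 + m%:R + (expR c - 1)^-1.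
Proof.
move=> c0 Nm; pose F t := Num.min 1 (2 * N%:R * expR (- (c * t%:R))).
have F0 t : 0 <= F t by rewrite le_min ler01 !mulr_ge0// expR_ge0.
have x1 : 0 < expR c - 1 by rewrite subr_gt0 expR_gt1.
have F1 t : F t <= 1 by rewrite ge_min lexx.
apply: (@le_trans _ _ (\sum_(t < m.+1 + T) F t)).
  rewrite addnC big_split_ord /= lerDl sumr_ge0//.
rewrite big_split_ord /=.
have x01 : 0 < expR c by exact: expR_gt0.
rewrite lerD//.
  rewrite nat1r -[leRHS]mulr1 mulr_natl -[m.+1 in leRHS]card_ord -sumr_const.
  by apply: ler_sum => i _; exact: F1.
rewrite -div1r ler_pdivlMr// mulr_suml.
(* Multiplied by [expR c - 1], the tail telescopes. *)
apply: (@le_trans _ _ (\sum_(i < T) (expR (- (c * i%:R)) - expR (- (c * i.+1%:R))))).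
  apply: ler_sum => i _.
  apply: (@le_trans _ _ (expR (- (c * i.+1%:R)) * (expR c - 1))).
    rewrite ler_wpM2r ?(ltW x1)// ge_min; apply/orP; right.
    have -> : c * (m.+1 + i)%:R = c * m%:R + c * i.+1%:R.
      by rewrite -mulrDr -natrD addnS addSn.
    rewrite opprD expRD mulrA ler_piMl ?expR_ge0//.
    by rewrite expRN ler_pdivrMr ?expR_gt0// mul1r.
  rewrite mulrBr mulr1 -expRD lerB//.
  have -> : - (c * i.+1%:R) + c = - (c * i%:R) by rewrite -natr1; ring.
  exact: lexx.
rewrite (_ : \sum_(i < T) _ = 1 - expR (- (c * T%:R))).
  by rewrite gerBl expR_ge0.
elim: T => [|T IH]; first by rewrite big_ord0 mulr0 oppr0 expR0 subrr.
by rewrite big_ord_recr /= IH addrA subrK.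
Qed.

End logistic.

(** * Clipped rewards and tilted policies *)

Section rewards.
Context {R : realType} {d : measure_display} {X : measurableType d}
  {A : pseudoPMetricType R}.
Variables (pi0 : R.-pker X ~> Borel A) (b : R).
Implicit Types (f g : @reward R d X A).

Lemma supnorm_leP f (e : R) :
  (supnorm pi0 f <= e%:E)%E <-> (forall x a, supp pi0 x a -> `|f x a| <= e).
Proof.
split=> [fe x a sa|fe].
  rewrite -lee_fin; apply: le_trans fe; apply: ereal_sup_ubound.
  by exists (x, a).
by apply: ge_ereal_sup => _ [[x a] /= sa <-]; rewrite lee_fin fe.
Qed.

(* Rewards are unconstrained off the support; clipping bounds them there and
   leaves them unchanged on it. *)
Definition clip f : @reward R d X A :=
  fun x a => Num.max (- b) (Num.min b (f x a)).

Definition bounded_reward f :=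
  measurable_fun setT (fun z : X * Borel A => f z.1 z.2) /\
  (forall x a, supp pi0 x a -> `|f x a| <= b).

Hypothesis b0 : 0 <= b.

Lemma clip_le f x a : `|clip f x a| <= b.
Proof.
rewrite /clip ler_norml le_max lexx /= ge_max ge_min lexx /=.
by rewrite andbT; have := b0; lra.
Qed.

Lemma clipE f x a : bounded_reward f -> supp pi0 x a -> clip f x a = f x a.
Proof.
move=> [_ fb] sa; have := fb _ _ sa; rewrite ler_norml => /andP[h1 h2].
by rewrite /clip (min_idPr h2) (max_idPr h1).
Qed.

Lemma bmeas_clip_pair f : bounded_reward f ->
  bmeas (fun z : X * Borel A => clip f z.1 z.2).
Proof. by move=> [mf _]; apply: bmeas_clip => //; have := b0; lra. Qed.

Notation slate := (X * Borel A * Borel A)%type.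

Lemma measurable_slate2 :
  measurable_fun setT (fun z : slate => (z.1.1, z.2) : X * Borel A).
Proof. by apply: measurable_fun_pair => //; exact: measurableT_comp. Qed.

Lemma bmeas_clip1 f : bounded_reward f ->
  bmeas (fun z : slate => clip f z.1.1 z.1.2).
Proof.
move=> bf; apply: (bmeas_comp (fun z : slate => z.1)
  (fun z : X * Borel A => clip f z.1 z.2)); last exact: bmeas_clip_pair.
exact: measurable_fst.
Qed.

Lemma bmeas_clip2 f : bounded_reward f ->
  bmeas (fun z : slate => clip f z.1.1 z.2).
Proof.
move=> bf; exact: (bmeas_comp _ _ measurable_slate2 (bmeas_clip_pair _ bf)).
Qed.

Lemma bmeas_ell (v1 v2 : slate -> R) (y : bool) :
  bmeas v1 -> bmeas v2 -> bmeas (fun z => ell (v1 z) (v2 z) y).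
Proof.
move=> b1 b2; have [m1 [M hM]] := b1; have [m2 [N hN]] := b2; split.
  apply: measurable_funB; last by case: y.
  apply: measurableT_comp; first exact: measurable_ln.
  by apply: measurable_funD; apply: measurableT_comp => //; exact: measurable_expR.
exists (ln 2 + 2 * (M + N)) => z.
rewrite ger0_norm ?ell_ge0//; apply: ell_le.
  by rewrite (le_trans (hM z))// lerDl (le_trans _ (hN z)).
by rewrite (le_trans (hN z))// lerDr (le_trans _ (hM z)).
Qed.

Lemma bmeas_pref (v1 v2 : slate -> R) (y : bool) :
  bmeas v1 -> bmeas v2 -> bmeas (fun z => pref (v1 z) (v2 z) y).
Proof.
move=> b1 b2.
have -> : (fun z => pref (v1 z) (v2 z) y) =
    (fun z => expR (- ell (v1 z) (v2 z) y)).
  by apply/funext => z; rewrite ell_ln_pref opprK lnK// posrE pref_gt0.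
by apply: bmeas_expR; apply: bmeasN; exact: bmeas_ell.
Qed.

End rewards.

Section tilting.
Context {R : realType} {d : measure_display} {X : measurableType d}
  {A : pseudoPMetricType R}.
Variables (d0 : probability X R) (pi0 : R.-pker X ~> Borel A).
Hypothesis A_separable : exists2 D : set A, countable D & closure D = setT.
Variables (b eta : R).
Hypotheses (b0 : 0 <= b) (eta0 : 0 < eta).
Implicit Types (f g : @reward R d X A).
Notation slate := (X * Borel A * Borel A)%type.
Notation bounded_reward := (bounded_reward pi0 b).
Notation clip := (clip b).

Let bmeas_exp_clip f : bounded_reward f ->
  bmeas (fun z : X * Borel A => expR (eta * clip f z.1 z.2)).
Proof.
by move=> bf; apply: bmeas_expR; apply: bmeasZ; exact: (bmeas_clip_pair pi0).
Qed.

Definition clip_tiltZ f x : R :=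
  kint pi0 (fun z : X * Borel A => expR (eta * clip f z.1 z.2)) x.

Lemma tiltZE f x : bounded_reward f -> tiltZ pi0 eta f x = (clip_tiltZ f x)%:E.
Proof.
move=> bf; rewrite /clip_tiltZ -kintE; last exact: bmeas_exp_clip.
apply: (eq_integral_conull _ _ (measurable_supp _ x) (supp_conull _ _ x)) => //.
by move=> a sa /=; rewrite (clipE pi0).
Qed.

Lemma clip_tiltZ_bounds f x : bounded_reward f ->
  expR (- (eta * b)) <= clip_tiltZ f x <= expR (eta * b).
Proof.
move=> bf; have be := bmeas_exp_clip _ bf.
have kc c : kint pi0 (fun=> c) x = c by exact: kint_cst_section.
rewrite -{1}[expR (- _)]kc -[X in _ && (_ <= X)]kc.
apply/andP; split; apply: kint_le => //; try exact: bmeas_cst.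
- move=> z; rewrite ler_expR -mulrN ler_pM2l//.
  by have := clip_le _ b0 f x z; rewrite ler_norml => /andP[].
- move=> z; rewrite ler_expR ler_pM2l//.
  by have := clip_le _ b0 f x z; rewrite ler_norml => /andP[].
Qed.

Lemma clip_tiltZ_gt0 f x : bounded_reward f -> 0 < clip_tiltZ f x.
Proof.
by move=> /(clip_tiltZ_bounds _ x)/andP[+ _]; apply: lt_le_trans; exact: expR_gt0.
Qed.

Lemma tilt_densityE f x a : bounded_reward f ->
  tilt_density pi0 eta f x a = expR (eta * f x a) / clip_tiltZ f x.
Proof. by move=> bf; rewrite /tilt_density tiltZE. Qed.

Lemma tilt_density_ge0 f x a : 0 <= tilt_density pi0 eta f x a.
Proof.
by rewrite divr_ge0 ?expR_ge0// fine_ge0// integral_ge0.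
Qed.

(** The normalizer cancels and [eta^-1] undoes the tilt: minimizing the DPO loss is minimizing the
    empirical logistic loss of the reward itself. *)
Lemma logratio_sub f x a1 a2 : bounded_reward f ->
  eta^-1 * (logratio pi0 eta f x a1 - logratio pi0 eta f x a2) =
  f x a1 - f x a2.
Proof.
move=> bf; have Z0 := clip_tiltZ_gt0 _ x bf.
rewrite /logratio !tilt_densityE// !ln_div ?posrE ?expR_gt0// !expRK.
by field; rewrite gt_eqF.
Qed.

Lemma dpo_lossE t (w : nat -> step X A) f : bounded_reward f ->
  dpo_loss pi0 eta t w f = (t%:R)^-1 *
    \sum_(s < t) ell (f (st_x (w s)) (st_a1 (w s)))
                     (f (st_x (w s)) (st_a2 (w s))) (st_y (w s)).
Proof.
move=> bf; congr (_ * _); apply: eq_bigr => s _.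
by rewrite logratio_sub// -ell_sigmoid; case: (st_y _).
Qed.

(** Off the support [tilt_density] may be arbitrarily large; the cap is its upper bound [beta] on
    the support. *)
Definition clip_density f (z : X * Borel A) : R :=
  Num.max 0 (Num.min (expR (2 * eta * b)) (tilt_density pi0 eta f z.1 z.2)).

(** Numerator and normalizer both lie between [expR (- (eta * b))] and [expR (eta * b)]. The lower
    bound, used once per arm, produces the factor [beta ^- 2]. *)
Lemma tilt_density_bounds f x a : bounded_reward f -> supp pi0 x a ->
  expR (- (2 * eta * b)) <= tilt_density pi0 eta f x a <= expR (2 * eta * b).
Proof.
move=> bf sa; rewrite tilt_densityE//.
have /andP[Z1 Z2] := clip_tiltZ_bounds _ x bf.
have Z0 := clip_tiltZ_gt0 _ x bf.
have /andP[f1 f2] : - b <= f x a <= b by rewrite -ler_norml; case: bf => _; exact.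
have eb : 2 * eta * b = eta * b + eta * b by ring.
rewrite ler_pdivlMr// ler_pdivrMr//; apply/andP; split.
  apply: (@le_trans _ _ (expR (- (2 * eta * b)) * expR (eta * b))).
    by rewrite ler_pM2l ?expR_gt0.
  by rewrite -expRD ler_expR eb opprD addrNK -mulrN ler_pM2l.
apply: (@le_trans _ _ (expR (2 * eta * b) * expR (- (eta * b)))); last first.
  by rewrite ler_pM2l ?expR_gt0.
by rewrite -expRD ler_expR eb addrK ler_pM2l.
Qed.

Lemma clip_densityE f x a : bounded_reward f -> supp pi0 x a ->
  clip_density f (x, a) = tilt_density pi0 eta f x a.
Proof.
move=> bf sa; have /andP[h1 h2] := tilt_density_bounds _ _ _ bf sa.
rewrite /clip_density /= (min_idPr h2) (max_idPr _)//.
exact: tilt_density_ge0.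
Qed.

Lemma clip_density_ge0 f z : 0 <= clip_density f z.
Proof. by rewrite le_max lexx. Qed.

Lemma bmeas_clip_density f : bounded_reward f -> bmeas (clip_density f).
Proof.
move=> bf; apply: bmeas_clip; last exact: expR_ge0.
have -> : (fun z : X * Borel A => tilt_density pi0 eta f z.1 z.2) =
    (fun z => expR (eta * f z.1 z.2 - ln (clip_tiltZ f z.1))).
  apply/funext => z; rewrite tilt_densityE// expRB lnK// posrE.
  exact: clip_tiltZ_gt0.
apply: measurableT_comp; first exact: measurable_expR.
apply: measurable_funB.
  by apply: measurable_funM => //; case: bf.
apply: measurableT_comp; first exact: measurable_ln.
apply: measurableT_comp => //.
by have [] := bmeas_kint pi0 _ (bmeas_exp_clip _ bf).
Qed.

Lemma kint_clip_density f x : bounded_reward f -> kint pi0 (clip_density f) x = 1.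
Proof.
move=> bf.
have bc := bmeas_exp_clip _ bf.
have -> : kint pi0 (clip_density f) x = kint pi0
    (fun z => (clip_tiltZ f x)^-1 * expR (eta * clip f z.1 z.2)) x.
  congr fine.
  apply: (eq_integral_conull _ _ (measurable_supp _ x) (supp_conull _ _ x)) => //.
  move=> a sa; congr EFin.
  by rewrite clip_densityE// tilt_densityE//= (clipE pi0)// mulrC.
by rewrite kintZ// mulVf// gt_eqF// clip_tiltZ_gt0.
Qed.

(** Integrates out the second arm; used with [c = 1] for a normalized density and with [c = 0] for a
    difference of centered rewards. *)
Lemma slate_int_snd (s h : X * Borel A -> R) (c : R) : bmeas s -> bmeas h ->
  (forall x, kint pi0 h x = c) ->
  slate_int pi0 d0 (fun z => s z.1 * h (z.1.1, z.2)) =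
  c * slate_int pi0 d0 (fun z => s z.1).
Proof.
move=> bs bh hc.
have bs1 : bmeas (fun z : slate => s z.1).
  by apply: (bmeas_comp (fun z : slate => z.1) s) => //; exact: measurable_fst.
rewrite -slate_intZ; last exact: bs1.
rewrite !slate_int_unlock; apply: eq_Rintegral => x _.
apply: eq_Rintegral => a1 _.
rewrite (kint_cst_section _ (s (x, a1) * kint pi0 h x) (fun z => c * s z.1)).
  by rewrite -kintZ.
by move=> z; rewrite hc mulrC.
Qed.

Lemma slate_int_fst (s : X * Borel A -> R) :
  slate_int pi0 d0 (fun z => s z.1) = \int[d0]_x kint pi0 s x.
Proof.
rewrite slate_int_unlock; apply: eq_Rintegral => x _; apply: eq_Rintegral => a1 _.
exact: kint_cst_section.
Qed.

Lemma slate_int_density f : bounded_reward f ->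
  slate_int pi0 d0 (fun z => clip_density f z.1 * clip_density f (z.1.1, z.2)) = 1.
Proof.
move=> bf; have bd := bmeas_clip_density _ bf.
rewrite (slate_int_snd _ _ 1)//; last by move=> x; exact: kint_clip_density.
rewrite mul1r slate_int_fst (_ : (fun x => _) = cst 1).
  by rewrite Rintegral_cst// [X in fine X]probability_setT /= mulr1.
by apply/funext => x; exact: kint_clip_density.
Qed.

End tilting.

(** * Concentration along the online process *)

(** Moment generating function of the excess loss on one slate. Under the true preference law its
    mean is [kl], and both losses lie in [[0, ln 2 + 2 * b]], which puts the exponent in the range
    of [expR_le_quadratic]. *)
Lemma pref_expR_le {R : realType} (b l u1 u2 v1 v2 : R) :
  `|u1| <= b -> `|u2| <= b -> `|v1| <= b -> `|v2| <= b ->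
  0 <= l -> l * (ln 2 + 2 * b) <= 4^-1 ->
  pref u1 u2 true * expR (- (l * (ell v1 v2 true - ell u1 u2 true)))
  + pref u1 u2 false * expR (- (l * (ell v1 v2 false - ell u1 u2 false)))
  <= 1 + (l * (ln 2 + 2 * b)) ^+ 2 - l * kl u1 u2 v1 v2.
Proof.
move=> hu1 hu2 hv1 hv2 l0 lM; set M := ln 2 + 2 * b in lM *.
have Z_le y : `|l * (ell v1 v2 y - ell u1 u2 y)| <= l * M.
  rewrite normrM (ger0_norm l0) ler_wpM2l//.
  have := ell_ge0 v1 v2 y; have := ell_ge0 u1 u2 y.
  have := ell_le b v1 v2 y hv1 hv2; have := ell_le b u1 u2 y hu1 hu2.
  by rewrite ler_norml -/M => ? ? ? ?; apply/andP; split; lra.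
have exp_le y : expR (- (l * (ell v1 v2 y - ell u1 u2 y))) <=
    1 + (l * M) ^+ 2 - l * (ell v1 v2 y - ell u1 u2 y).
  apply: (le_trans (expR_le_quadratic _ _)).
    by rewrite normrN (le_trans (Z_le y)).
  rewrite sqrrN addrAC lerD2r lerD2l -real_normK ?num_real//.
  by rewrite ler_sqr ?nnegrE// (le_trans _ (Z_le y)).
have := pref_sum u1 u2; have := pref_gt0 u1 u2 true; have := pref_gt0 u1 u2 false.
have := exp_le true; have := exp_le false; rewrite /kl.
move: (pref _ _ true) (pref _ _ false) (expR _) (expR _) => p q e1 e2.
set z1 := _ - ell u1 u2 false; set z2 := _ - ell u1 u2 true.
move=> h1 h2 q0 p0 pq.
have -> : 1 + (l * M) ^+ 2 - l * (p * z2 + q * z1) =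
  p * (1 + (l * M) ^+ 2 - l * z2) + q * (1 + (l * M) ^+ 2 - l * z1).
  have -> : 1 + (l * M) ^+ 2 - l * (p * z2 + q * z1) =
    (p + q) * (1 + (l * M) ^+ 2) - l * (p * z2 + q * z1) by rewrite pq mul1r.
  ring.
by rewrite lerD// ler_wpM2l// ltW.
Qed.

Lemma bmeas_kl {R : realType} {d} {X : measurableType d} {A : pseudoPMetricType R}
    (u1 u2 v1 v2 : X * Borel A * Borel A -> R) :
  bmeas u1 -> bmeas u2 -> bmeas v1 -> bmeas v2 ->
  bmeas (fun z => kl (u1 z) (u2 z) (v1 z) (v2 z)).
Proof.
move=> bu1 bu2 bv1 bv2; rewrite /kl; apply: bmeasD; apply: bmeasM.
- exact: bmeas_pref.
- by apply: bmeasB; exact: bmeas_ell.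
- exact: bmeas_pref.
- by apply: bmeasB; exact: bmeas_ell.
Qed.

Section online.
Context {R : realType} {d : measure_display} {X : measurableType d}
  {A : pseudoPMetricType R}.
Variables (d0 : probability X R) (pi0 : R.-pker X ~> Borel A).
Hypothesis A_separable : exists2 D : set A, countable D & closure D = setT.
Variables (b eta : R).
Hypotheses (b0 : 0 <= b) (eta0 : 0 < eta).
Notation slate := (X * Borel A * Borel A)%type.
Notation bounded_reward := (bounded_reward pi0 b).
Notation clip := (clip b).
Notation slate_int := (slate_int pi0 d0).
Notation density := (clip_density pi0 b eta).
Variable Rtrue : @reward R d X A.
Hypothesis Rtrue_bounded : bounded_reward Rtrue.
Implicit Types (f q : @reward R d X A) (g : slate -> bool -> R).

Definition pref_avg g (z : slate) : R :=
  let u1 := clip Rtrue z.1.1 z.1.2 in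
  let u2 := clip Rtrue z.1.1 z.2 in
  pref u1 u2 true * g z true + pref u1 u2 false * g z false.

Lemma prefPE f x a1 a2 y : prefP f x a1 a2 y = pref (f x a1) (f x a2) y.
Proof. by []. Qed.

(* [round_int] for bounded integrands, with the truth and the density clipped. *)
Definition round_mean f g : R :=
  slate_int (fun z => density f z.1 * density f (z.1.1, z.2) * pref_avg g z).

Lemma bmeas_pref_avg g : (forall y, bmeas (g ^~ y)) -> bmeas (pref_avg g).
Proof.
move=> bg; have b1 := bmeas_clip1 _ _ b0 _ Rtrue_bounded.
have b2 := bmeas_clip2 _ _ b0 _ Rtrue_bounded.
by apply: bmeasD; apply: bmeasM => //; exact: bmeas_pref.
Qed.

Lemma bmeas_density2 f : bounded_reward f ->
  bmeas (fun z : slate => density f z.1 * density f (z.1.1, z.2)).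
Proof.
move=> bf; have bd := bmeas_clip_density _ A_separable _ _ b0 eta0 _ bf.
apply: bmeasM.
  by apply: (bmeas_comp (fun z : slate => z.1) (density f)) => //; exact: measurable_fst.
exact: (bmeas_comp _ (density f) measurable_slate2).
Qed.

Lemma round_int_le (rhat : nat -> Omega X A -> @reward R d X A) t w
    (G : step X A -> \bar R) g :
  bounded_reward (rhat t w) ->
  (forall st, 0 <= G st)%E ->
  (forall z y, 0 <= g z y) -> (forall y, bmeas (g ^~ y)) ->
  (forall x a1 a2 y, supp pi0 x a1 -> supp pi0 x a2 ->
     G (x, a1, a2, y) <= (g (x, a1, a2) y)%:E)%E ->
  (round_int d0 pi0 eta Rtrue rhat t w G <= (round_mean (rhat t w) g)%:E)%E.
Proof.
move=> bf G0 g0 bg Gg; have bd2 := bmeas_density2 _ bf.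
have P0 x a1 a2 y : (0 <= (prefP Rtrue x a1 a2 y)%:E)%E.
  by rewrite lee_fin prefPE ltW// pref_gt0.
apply: slate_int_ge => //.
- by apply: bmeasM => //; exact: bmeas_pref_avg.
- move=> x a1 a2; apply: mule_ge0.
    by rewrite lee_fin mulr_ge0//; exact: tilt_density_ge0.
  by apply: adde_ge0; apply: mule_ge0; (exact: G0 || exact: P0).
- move=> z; rewrite mulr_ge0//; first by rewrite mulr_ge0// clip_density_ge0.
  by rewrite addr_ge0// mulr_ge0// ltW// pref_gt0.
move=> x a1 a2 s1 s2; rewrite [leRHS]EFinM /= !(clip_densityE pi0 A_separable)//.
apply: lee_wpmul2l.
  by rewrite lee_fin mulr_ge0//; exact: tilt_density_ge0.
rewrite /pref_avg /= !(clipE pi0)// -!prefPE EFinD.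
rewrite (EFinM _ (g _ true)) (EFinM _ (g _ false)).
by apply: leeD; apply: lee_wpmul2l; (exact: P0 || exact: Gg).
Qed.

Lemma round_mean_sum f (I : Type) (s : seq I) (a : I -> R) (F : I -> slate -> bool -> R) :
  bounded_reward f -> (forall i y, bmeas ((F i) ^~ y)) ->
  round_mean f (fun z y => \sum_(i <- s) a i * F i z y) =
  \sum_(i <- s) a i * round_mean f (F i).
Proof.
move=> bf bF; have bd2 := bmeas_density2 _ bf.
have bi i : bmeas (fun z : slate => density f z.1 * density f (z.1.1, z.2) *
    pref_avg (F i) z) by apply: bmeasM => //; exact: bmeas_pref_avg.
transitivity (\sum_(i <- s) slate_int (fun z =>
    a i * (density f z.1 * density f (z.1.1, z.2) * pref_avg (F i) z))).
  rewrite -(slate_int_sum pi0 d0 _ s); last by move=> i; exact: bmeasZ.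
  congr (slate_int _); apply/funext => z.
  rewrite /pref_avg !mulr_sumr -big_split mulr_sumr; apply: eq_bigr => i _ /=.
  ring.
by apply: eq_bigr => i _; exact: slate_intZ.
Qed.

(* Chernoff bound for one round: the exponent trades the drift [15 / 16 * gam]
   of the excess loss of [q], less the tolerance [gam / 16], against its range. *)
Lemma round_mean_expR_le f q (gam : R) :
  bounded_reward f -> bounded_reward q ->
  let M := ln 2 + 2 * b in
  let l := gam / (4 * M ^+ 2) in
  0 <= gam <= M ->
  15 / 16 * gam <= expR (2 * eta * b) ^- 2 *
    slate_int (fun z => kl (clip Rtrue z.1.1 z.1.2) (clip Rtrue z.1.1 z.2)
                           (clip q z.1.1 z.1.2) (clip q z.1.1 z.2)) ->
  round_mean f (fun z y => expR (- (l *
      (ell (clip q z.1.1 z.1.2) (clip q z.1.1 z.2) y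
       - ell (clip Rtrue z.1.1 z.1.2) (clip Rtrue z.1.1 z.2) y - gam / 16))))
  <= expR (- (gam ^+ 2 / (128 * M ^+ 2))).
Proof.
move=> bf bq M l /andP[gam0 gamM]; set KL := (X in slate_int X) => drift.
have M0 : 0 < M by rewrite ltr_pwDl ?mulr_ge0// ln_gt0// ltr1n.
have l0 : 0 <= l by rewrite divr_ge0// mulr_ge0// sqr_ge0.
have lM : l * M = gam / (4 * M) by rewrite /l; field; rewrite gt_eqF.
have lM4 : l * M <= 4^-1.
  by rewrite lM ler_pdivrMr ?mulr_gt0// mulrA mulVf// mul1r.
have bd2 := bmeas_density2 _ bf.
have c1 := clip_le _ b0.
have t1 := bmeas_clip1 _ _ b0 _ Rtrue_bounded.
have t2 := bmeas_clip2 _ _ b0 _ Rtrue_bounded.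
have q1 := bmeas_clip1 _ _ b0 _ bq; have q2 := bmeas_clip2 _ _ b0 _ bq.
have bKL : bmeas KL by exact: bmeas_kl.
have KL0 z : 0 <= KL z by exact: (kl_ge0 b).
set C := expR (l * (gam / 16)); set B2 := expR (2 * eta * b) ^- 2 in drift *.
pose D2 := fun z : slate => density f z.1 * density f (z.1.1, z.2).
(* The constant part keeps the density [D2], whose integral is exactly 1; only the nonnegative [KL]
   part is lowered from [D2] to [B2]. *)
apply: (@le_trans _ _ (slate_int (fun z =>
    C * ((1 + (l * M) ^+ 2) * D2 z - l * B2 * KL z)))).
  apply: slate_int_le => //.
  - apply: bmeasM => //; apply: bmeas_pref_avg => y; apply: bmeas_expR.
    apply: bmeasN; apply: bmeasZ; apply: bmeasB; last exact: bmeas_cst.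
    by apply: bmeasB; exact: bmeas_ell.
  - by apply: bmeasZ; apply: bmeasB; exact: bmeasZ.
  move=> x a1 a2 s1 s2; set z := (x, a1, a2).
  have D20 : 0 <= D2 z by rewrite mulr_ge0// clip_density_ge0.
  have B2D : B2 <= D2 z.
    have h a : supp pi0 x a -> (expR (2 * eta * b))^-1 <= density f (x, a).
      move=> sa; rewrite clip_densityE// -expRN.
      by have /andP[] := tilt_density_bounds _ A_separable _ _ b0 eta0 _ _ _ bf sa.
    by rewrite /B2 /D2 -exprVn expr2 ler_pM ?h// invr_ge0 expR_ge0.
  apply: (@le_trans _ _ (D2 z * (C * (1 + (l * M) ^+ 2 - l * KL z)))).
    rewrite ler_wpM2l//.
    have -> : pref_avg (fun (z : slate) y => expR (- (l *
      (ell (clip q z.1.1 z.1.2) (clip q z.1.1 z.2) y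
       - ell (clip Rtrue z.1.1 z.1.2) (clip Rtrue z.1.1 z.2) y - gam / 16)))) z =
      C * pref_avg (fun (z : slate) y => expR (- (l *
      (ell (clip q z.1.1 z.1.2) (clip q z.1.1 z.2) y
       - ell (clip Rtrue z.1.1 z.1.2) (clip Rtrue z.1.1 z.2) y)))) z.
      rewrite /pref_avg [RHS]mulrDr (mulrCA C (pref _ _ true)).
      rewrite (mulrCA C (pref _ _ false)) /C -!expRD.
      by congr (_ * expR _ + _ * expR _); ring.
    rewrite ler_wpM2l ?expR_ge0//.
    exact: pref_expR_le.
  have -> : D2 z * (C * (1 + (l * M) ^+ 2 - l * KL z)) =
    C * ((1 + (l * M) ^+ 2) * D2 z - l * (D2 z * KL z)) by ring.
  rewrite ler_wpM2l ?expR_ge0// lerB// -mulrA ler_wpM2l// ler_wpM2r//.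
rewrite slate_intZ; last by apply: bmeasB; exact: bmeasZ.
rewrite slate_intB; [|exact: bmeasZ..].
rewrite (slate_intZ _ _ _ D2)// (slate_intZ _ _ _ KL)//.
rewrite slate_int_density// mulr1.
apply: (@le_trans _ _ (C * expR ((l * M) ^+ 2 - l * (15 / 16 * gam)))).
  rewrite ler_wpM2l ?expR_ge0//; apply: le_trans (expR_ge1Dx _).
  by rewrite addrA lerB// -[leRHS]mulrA ler_wpM2l.
rewrite /C -expRD ler_expR lM.
(* For this [l] the exponent is 20 times the claimed one. *)
have -> : l * (gam / 16) + ((gam / (4 * M)) ^+ 2 - l * (15 / 16 * gam)) =
  - (20 * (gam ^+ 2 / (128 * M ^+ 2))).
  by rewrite /l; field; rewrite gt_eqF.
rewrite lerN2 ler_peMl//; first by rewrite divr_ge0 ?sqr_ge0// mulr_ge0// sqr_ge0.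
by rewrite ler1n.
Qed.

Variable rhat : nat -> Omega X A -> @reward R d X A.
Hypothesis rhat_bounded : forall t w, bounded_reward (rhat t w).

Definition path_supp (s : nat) (w : nat -> step X A) := forall i, (i < s)%N ->
  supp pi0 (st_x (w i)) (st_a1 (w i)) /\ supp pi0 (st_x (w i)) (st_a2 (w i)).

Lemma Vfrom_ge0 (f : (nat -> step X A) -> \bar R) :
  (forall w, 0 <= f w)%E ->
  forall k t w, (0 <= Vfrom d0 pi0 eta Rtrue rhat t k f w)%E.
Proof.
have P0 x a1 a2 y : (0 <= (prefP Rtrue x a1 a2 y)%:E)%E.
  by rewrite lee_fin prefPE ltW// pref_gt0.
move=> f0; elim=> [|k IH] t w; first exact: f0.
rewrite /= /round_int; apply: integral_ge0 => x _.
apply: integral_ge0 => a1 _; apply: integral_ge0 => a2 _.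
apply: mule_ge0; first by rewrite lee_fin mulr_ge0//; exact: tilt_density_ge0.
by apply: adde_ge0; apply: mule_ge0; (exact: IH || exact: P0).
Qed.

(* [H] is a supermartingale dominating [f]; [f] need not be measurable. *)
Lemma expect_le_supermartingale (T : nat) (f : (nat -> step X A) -> \bar R)
    (H : nat -> (nat -> step X A) -> R) :
  (forall w, 0 <= f w)%E ->
  (forall w, path_supp T w -> f w <= (H T w)%:E)%E ->
  (forall s w (G : step X A -> \bar R), (s < T)%N ->
     (forall st, 0 <= G st)%E ->
     (forall x a1 a2 y, supp pi0 x a1 -> supp pi0 x a2 ->
        G (x, a1, a2, y) <= (H s.+1 (upd w s (x, a1, a2, y)))%:E)%E ->
     round_int d0 pi0 eta Rtrue rhat s w G <= (H s w)%:E)%E ->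
  (expect d0 pi0 eta Rtrue rhat T f <= (H 0 point)%:E)%E.
Proof.
move=> f0 fH Hstep.
suff main k : forall s w, (s + k)%N = T -> path_supp s w ->
    (Vfrom d0 pi0 eta Rtrue rhat s k f w <= (H s w)%:E)%E by exact: main.
elim: k => [|k IH] s w sT ws.
  by rewrite addn0 in sT; rewrite -sT in fH; exact: fH.
apply: Hstep => [|st|x a1 a2 y s1 s2]; first by rewrite -sT addnS ltnS leq_addr.
  exact: Vfrom_ge0.
apply: IH => [|i]; first by rewrite addSnnS.
rewrite ltnS leq_eqVlt /upd => /predU1P[->|/[dup] si /ltn_eqF ->]; last exact: ws.
by rewrite eqxx.
Qed.

(** The union bound: [f] is dominated by a sum over [L] of products of round weights, each of
    conditional mean at most [theta]. *)
Lemma expect_le_sum (T : nat) (f : (nat -> step X A) -> \bar R) (I : Type)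
    (L : seq I) (phi : I -> slate -> bool -> R) (K theta : R) :
  0 <= K -> 0 <= theta ->
  (forall i z y, 0 <= phi i z y) -> (forall i y, bmeas ((phi i) ^~ y)) ->
  (forall i t w, round_mean (rhat t w) (phi i) <= theta) ->
  (forall w, 0 <= f w)%E ->
  (forall w, path_supp T w ->
     f w <= (K * \sum_(i <- L) \prod_(s < T) phi i (w s).1 (w s).2)%:E)%E ->
  (expect d0 pi0 eta Rtrue rhat T f <= (K * ((size L)%:R * theta ^+ T))%:E)%E.
Proof.
move=> K0 th0 phi0 bphi phi_le f0 fL.
(* Rounds already played enter through their weights, the [T - s] rounds to come through the bound
   [theta]. *)
pose H s (w : nat -> step X A) : R :=
  \sum_(i <- L) (K * theta ^+ (T - s) * \prod_(r < s) phi i (w r).1 (w r).2).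
have -> : K * ((size L)%:R * theta ^+ T) = H 0 point.
  rewrite /H subn0; under eq_bigr do rewrite big_ord0 mulr1.
  by rewrite big_const_seq count_predT iter_addr_0 -mulr_natl; ring.
apply: expect_le_supermartingale => //.
  by move=> w /fL /le_trans; apply; rewrite /H subnn expr0 mulr1 -mulr_sumr.
move=> s w G sT G0 GH.
pose a i := K * theta ^+ (T - s.+1) * \prod_(r < s) phi i (w r).1 (w r).2.
have a0 i : 0 <= a i.
  by rewrite mulr_ge0// ?prodr_ge0// mulr_ge0// exprn_ge0.
apply: (le_trans (round_int_le rhat s w G
  (fun z y => \sum_(i <- L) a i * phi i z y) _ _ _ _ _)) => //.
- by move=> z y; apply: sumr_ge0 => i _; rewrite mulr_ge0.
- by move=> y; apply: bmeas_sum => i; exact: bmeasZ.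
- move=> x a1 a2 y s1 s2; apply: (le_trans (GH _ _ _ _ s1 s2)).
  rewrite lee_fin /H; apply: ler_sum => i _.
  rewrite big_ord_recr /= /upd eqxx mulrA /a.
  rewrite (eq_bigr (fun r : 'I_s => phi i (w r).1 (w r).2))// => r _.
  by rewrite ltn_eqF.
rewrite lee_fin round_mean_sum//; apply: ler_sum => i _.
apply: (@le_trans _ _ (a i * theta)); first by rewrite ler_wpM2l.
by rewrite /a mulrAC -[X in X * _ <= _]mulrA -exprSr subnSK.
Qed.

End online.

(** * Compactness in the supremum norm *)

(** Nonpositive values are skipped, so that it applies to a family of centres among which some
    quantities vanish. *)
Lemma finite_set_pos_lbound {R : realType} (T : Type) (J : set T) (m : T -> R) :
  finite_set J ->
  exists2 e : R, 0 < e & forall j, J j -> 0 < m j -> e <= m j.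
Proof.
move=> /(finite_image m)/finite_seqP[s sE].
have [e e0 es] : exists2 e : R, 0 < e & forall x, x \in s -> 0 < x -> e <= x.
  elim: s {sE} => [|x s [e e0 IH]]; first by exists 1.
  have [x0|x0] := ltP 0 x; last first.
    exists e => // y; rewrite inE => /predU1P[->|]; last exact: IH.
    by rewrite ltNge x0.
  exists (Num.min x e) => [|y]; first by rewrite lt_min x0.
  rewrite inE => /predU1P[->|ys] y0; first by rewrite ge_min lexx.
  by rewrite ge_min IH// orbT.
exists e => // j Jj; apply: es.
by have : [set` s] (m j) by rewrite -sE; exists j.
Qed.

Section compactness.
Context {R : realType} {d : measure_display} {X : measurableType d}
  {A : pseudoPMetricType R}.
Variables (pi0 : R.-pker X ~> Borel A).
Implicit Types (f g h : @reward R d X A).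

Lemma sup_open_ball f (e : R) :
  sup_open pi0 [set g | (supnorm pi0 (rdiff g f) < e%:E)%E].
Proof.
move=> g /= ge.
have [s se gs] : exists2 s : R, s < e & (supnorm pi0 (rdiff g f) <= s%:E)%E.
  move: ge; case: (supnorm _ _) => [r re| |_]; [by exists r|by []|].
  by exists (e - 1); [rewrite ltrBlDr ltrDl|rewrite leNye].
exists ((e - s) / 2) => [|h /ltW hg]; first by rewrite divr_gt0// subr_gt0.
apply: (@le_lt_trans _ _ ((e - s) / 2 + s)%:E); last by rewrite lte_fin; lra.
apply/supnorm_leP => x a sa; rewrite /rdiff.
have -> : h x a - f x a = (h x a - g x a) + (g x a - f x a) by ring.
apply: (le_trans (ler_normD _ _)); apply: lerD.
  by move/supnorm_leP : hg; exact.
by move/supnorm_leP : gs; exact.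
Qed.

(** The radius depends on the centre, so that each centre can demand its own precision, as in
    [dist1_uniform]. *)
Lemma sup_compact_cover (P : Type) (Rp : P -> @reward R d X A) (r : P -> R) :
  sup_compact pi0 (range Rp) -> (forall p, 0 < r p) ->
  exists2 J : set P, finite_set J & forall q, exists2 p, J p &
    forall x a, supp pi0 x a -> `|Rp q x a - Rp p x a| < r p.
Proof.
move=> cK r0.
have [|_ [q _ <-]|J fJ KJ] := cK P (fun p => [set g | (supnorm pi0 (rdiff g (Rp p)) < (r p)%:E)%E]).
- by move=> p; exact: sup_open_ball.
- exists q => //=; apply: (@le_lt_trans _ _ 0%:E); last by rewrite lte_fin.
  by apply/supnorm_leP => x a _; rewrite /rdiff subrr normr0.
exists J => // q; have [p Jp /= qp] := KJ _ (ex_intro2 _ _ q I erefl).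
exists p => // x a sa; rewrite -lte_fin; apply: le_lt_trans qp.
by apply: ereal_sup_ubound; exists (x, a).
Qed.

(** If the functions differ at a support point, they differ on the trace on the support of an open
    neighbourhood. That neighbourhood would be null, against the definition of the support. *)
Lemma continuous_eq_supp x (f g : A -> R) :
  {within supp pi0 x, continuous f} -> {within supp pi0 x, continuous g} ->
  (pi0 x).-negligible [set a | supp pi0 x a /\ f a <> g a] ->
  pi0 x (~` supp pi0 x) = 0%E ->
  forall a, supp pi0 x a -> f a = g a.
Proof.
move=> /subspace_continuousP cf /subspace_continuousP cg fg S0 a sa.
apply: contrapT => fga.
have h0 : 0 < `|f a - g a| by rewrite normr_gt0 subr_eq0; exact/eqP.
have cfg : (fun b => f b - g b) @ within (supp pi0 x) (nbhs a) --> f a - g a.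
  by apply: cvgB; [exact: cf|exact: cg].
have /cvgr_dist_lt/(_ _ h0) := cfg.
rewrite near_withinE => -/nbhs_interior.
set V := (V in nbhs a V°) => Va.
have Uo : open V° by exact: open_interior.
have Ua : V° a.
  exact: nbhs_singleton Va.
have := sa _ Uo Ua; rewrite ltNge => /negP; apply.
have : (pi0 x).-negligible (V° : set (Borel A)).
  have N0 : (pi0 x).-negligible (~` supp pi0 x : set (Borel A)).
    by apply/negligibleP => //; exact: measurableC (measurable_supp pi0 x).
  apply: negligibleS (negligibleU fg N0).
  move=> b /interior_subset Vb; have [sb|] := pselect (supp pi0 x b); last by right.
  left; split => // fgb; have := Vb sb.
  by rewrite fgb subrr subr0 ltxx.
by move=> /negligibleP -> //; exact: borel_open.
Qed.

End compactness.

(** * Greedy selectors and regret *)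

Section truths.
Context {R : realType} {d : measure_display} {X : measurableType d}
  {A : pseudoPMetricType R}.
Hypothesis A_separable : exists2 D : set A, countable D & closure D = setT.
Variables (d0 : probability X R) (pi0 : R.-pker X ~> Borel A).
Variables (P : Type) (Rp : P -> @reward R d X A).
Hypothesis Rp_meas : forall p,
  measurable_fun setT (fun z : X * Borel A => Rp p z.1 z.2).
Hypothesis Rp_centered : forall p x, (\int[pi0 x]_a (Rp p x a)%:E = 0)%E.
Variable sel : @reward R d X A -> X -> A.
Hypothesis sel_argmax : forall Rw : @reward R d X A,
  (Rw = @zero_reward R d X A \/ exists p, Rw = Rp p) ->
  measurable_fun setT (sel Rw : X -> Borel A) /\ argmax_sel pi0 Rw (sel Rw).
Hypothesis Rp_compact : sup_compact pi0 (range Rp).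
Hypothesis Rp_cont :
  forall p, {ae d0, forall x, {within supp pi0 x, continuous (Rp p x)}}.
Variable Dmin : R.
Hypothesis Dmin_gt0 : 0 < Dmin.
Hypothesis gap : forall p, {ae d0, forall x,
  (forall a, supp pi0 x a -> a <> sel (Rp p) x -> Rp p x a < Rp p x (sel (Rp p) x))
  /\ (Dmin%:E <= (Rp p x (sel (Rp p) x))%:E
       - ereal_sup [set (Rp p x a)%:E |
                    a in [set a | supp pi0 x a /\ a <> sel (Rp p) x]])%E}.
Variable B : R.
Hypothesis B_sup : ereal_sup [set supnorm pi0 f | f in range Rp] = B%:E.

Lemma Rp_bounded p : bounded_reward pi0 B (Rp p).
Proof.
split=> // x a sa.
have /supnorm_leP : (supnorm pi0 (Rp p) <= B%:E)%E; last exact.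
by rewrite -B_sup; apply: ereal_sup_ubound; exists (Rp p) => //; exists p.
Qed.

(** The supremum over an empty class would be [-oo], whereas [B] is real. *)
Lemma truth_exists : exists p : P, True.
Proof.
apply: contrapT => noP; move: B_sup.
rewrite (_ : [set _ | _ in _] = set0) ?ereal_sup0//.
by apply/seteqP; split => // t [f [p _ _] _]; case: noP; exists p.
Qed.

Lemma B_ge0 : 0 <= B.
Proof.
have [p _] := truth_exists; have [_ pB] := Rp_bounded p.
have [a sa] := supp_nonempty pi0 A_separable point.
exact: le_trans (pB _ _ sa).
Qed.

Definition admissible (f : @reward R d X A) :=
  f = @zero_reward R d X A \/ exists p, f = Rp p.

Lemma admissible_Rp p : admissible (Rp p).
Proof. by right; exists p. Qed.

Lemma admissible_bounded f : admissible f -> bounded_reward pi0 B f.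
Proof.
move=> [->|[p ->]]; last exact: Rp_bounded.
split; first exact: measurable_cst.
by move=> x a _; rewrite normr0 B_ge0.
Qed.

Lemma sel_supp f x : admissible f -> supp pi0 x (sel f x).
Proof. by move=> /sel_argmax[_ /(_ x)[]]. Qed.

Lemma sel_max f x a : admissible f -> supp pi0 x a -> f x a <= f x (sel f x).
Proof. by move=> /sel_argmax[_ /(_ x)[_]]; exact. Qed.

Definition loss p (f : @reward R d X A) (x : X) : R :=
  Rp p x (sel (Rp p) x) - Rp p x (sel f x).

Lemma loss_ge0 p f x : admissible f -> 0 <= loss p f x.
Proof.
move=> af; rewrite subr_ge0; apply: sel_max; first exact: admissible_Rp.
exact: sel_supp.
Qed.

Lemma measurable_loss p f : admissible f -> measurable_fun setT (loss p f).
Proof.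
move=> af.
have ms g : admissible g -> measurable_fun setT (fun x => Rp p x (sel g x)).
  move=> ag; apply: (measurableT_comp (Rp_meas p)
    (g := fun x => (x, sel g x) : X * Borel A)).
  by apply: measurable_fun_pair => //; have [] := sel_argmax _ ag.
by apply: measurable_funB; apply: ms => //; exact: admissible_Rp.
Qed.

Lemma gap_ge p : {ae d0, forall x, forall a, supp pi0 x a ->
  a <> sel (Rp p) x -> Dmin <= Rp p x (sel (Rp p) x) - Rp p x a}.
Proof.
apply: filterS (gap p) => x [_ hD] a sa ax.
rewrite -lee_fin EFinB; apply: (le_trans hD); apply: leeB => //.
by apply: ereal_sup_ubound; exists a.
Qed.

Definition same_sel p q := {ae d0, forall x, sel (Rp p) x = sel (Rp q) x}.

Lemma same_sel_sym p q : same_sel p q -> same_sel q p.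
Proof. by apply: filterS => x ->. Qed.

Lemma same_sel_trans p q r : same_sel p q -> same_sel q r -> same_sel p r.
Proof. by apply: filterS2 => x -> ->. Qed.

(** Moving two values by less than [Dmin / 2] each cannot overturn a gap of [Dmin]. *)
Lemma same_sel_near p q :
  (forall x a, supp pi0 x a -> `|Rp q x a - Rp p x a| < Dmin / 2) ->
  same_sel q p.
Proof.
move=> qp; apply: filterS (gap_ge p) => x hD.
apply: contrapT => neq.
have sp : supp pi0 x (sel (Rp p) x) by apply: sel_supp; exact: admissible_Rp.
have sq : supp pi0 x (sel (Rp q) x) by apply: sel_supp; exact: admissible_Rp.
have := hD _ sq neq.
have := sel_max _ _ _ (admissible_Rp q) sp.
have := qp _ _ sp; have := qp _ _ sq.
by rewrite !ltr_norml => /andP[? ?] /andP[? ?]; lra.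
Qed.

Lemma subopt_same p q : same_sel p q -> subopt d0 sel (Rp p) (Rp q) = 0%E.
Proof.
move=> pq; rewrite /subopt -(@integral0 _ _ _ d0 setT).
apply: ae_eq_integral => //.
  apply/measurable_EFinP; apply: measurable_loss; exact: admissible_Rp.
by apply: filterS pq => x -> _; rewrite subrr.
Qed.

Definition regret_set p q := [set x | 0 < loss p (Rp q) x].

Lemma measurable_regret_set p q : measurable (regret_set p q).
Proof.
have := measurable_loss p _ (admissible_Rp q) measurableT `]0, +oo[%classic.
rewrite setTI => /(_ (measurable_itv _)).
by congr measurable; apply/seteqP; split => x /=; rewrite in_itv /= andbT.
Qed.

Lemma regret_set0_same p q : d0 (regret_set p q) = 0%E -> same_sel p q.
Proof.
move=> E0.
have : {ae d0, forall x, ~ regret_set p q x}.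
  exists (regret_set p q); split => //; first exact: measurable_regret_set.
  by move=> x /= /contrapT.
move: (gap p); apply: filterS2 => x [hD _] nE.
apply: contrapT => neq; apply: nE; rewrite /regret_set /loss /= subr_gt0.
by apply: hD; [apply: sel_supp; exact: admissible_Rp|exact/nesym].
Qed.

(** The bound depends on [p] and [q] only through representatives of their selectors, so over a
    finite cover it takes finitely many values. *)
Lemma subopt_ge p q i j : same_sel p i -> same_sel q j ->
  ((Dmin * fine (d0 (regret_set i j)))%:E <= subopt d0 sel (Rp p) (Rp q))%E.
Proof.
move=> pi qj; rewrite EFinM fineK ?fin_num_measure//; last exact: measurable_regret_set.
rewrite -(integral_cst d0 (measurable_regret_set i j)).
rewrite integral_mkcond; apply: ae_ge0_le_integral => //.
- by move=> x _; rewrite /patch; case: ifP => // _; rewrite lee_fin ltW.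
- apply/(measurable_restrictT _ _).1; first exact: measurable_regret_set.
  exact: measurable_cst.
- by move=> x _; rewrite lee_fin; apply: loss_ge0; exact: admissible_Rp.
- by apply/measurable_EFinP; apply: measurable_loss; exact: admissible_Rp.
move: (gap_ge p) pi qj; apply: filterS3 => x hD pix qjx _; rewrite /patch.
case: ifPn => [/set_mem xE|_].
  rewrite lee_fin; apply: hD; first by apply: sel_supp; exact: admissible_Rp.
  move=> e; move: xE; rewrite /regret_set /loss /=.
  by rewrite -pix -qjx e subrr ltxx.
by rewrite lee_fin; apply: loss_ge0; exact: admissible_Rp.
Qed.

Lemma subopt_dichotomy : exists2 eps0 : R, 0 < eps0 & forall p q,
  subopt d0 sel (Rp p) (Rp q) = 0%E \/ (eps0%:E <= subopt d0 sel (Rp p) (Rp q))%E.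
Proof.
have D20 : 0 < Dmin / 2 by rewrite divr_gt0.
have [J fJ cJ] := sup_compact_cover pi0 _ _ (fun=> Dmin / 2) Rp_compact (fun=> D20).
have [e e0 eJ] := finite_set_pos_lbound _ _
  (fun ij => Dmin * fine (d0 (regret_set ij.1 ij.2))) (finite_setX fJ fJ).
exists e => // p q.
have [i Ji /same_sel_near pi] := cJ p; have [j Jj /same_sel_near qj] := cJ q.
have [E0|E0] := eqVneq (d0 (regret_set i j)) 0%E.
  left; apply: subopt_same; apply: (same_sel_trans _ i) => //.
  apply: (same_sel_trans _ j); last exact: same_sel_sym.
  exact: regret_set0_same.
right; apply: le_trans (subopt_ge _ _ _ _ pi qj); rewrite lee_fin.
apply: (eJ (i, j)) => //=; rewrite mulr_gt0// fine_gt0//.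
rewrite lt0e E0 measure_ge0/= -ge0_fin_numE// fin_num_measure//.
exact: measurable_regret_set.
Qed.

Lemma subopt_ge0 p f : admissible f -> (0 <= subopt d0 sel (Rp p) f)%E.
Proof. by move=> af; apply: integral_ge0 => x _; rewrite lee_fin; exact: loss_ge0. Qed.

Lemma subopt_le p f (K : R) : admissible f ->
  (forall x a, supp pi0 x a -> Rp p x (sel (Rp p) x) - Rp p x a <= K) ->
  (subopt d0 sel (Rp p) f <= K%:E)%E.
Proof.
move=> af HK; apply: (@le_trans _ _ (\int[d0]_x (cst K%:E x))%E).
  apply: ge0_le_integralT => x; rewrite lee_fin; first exact: loss_ge0.
  by apply: HK; exact: sel_supp.
by rewrite integral_cst// [X in (_ * X)%E]probability_setT mule1.
Qed.

(** * Excess loss and L1 distance of rewards *)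

Let B0 := B_ge0.
Notation slate := (X * Borel A * Borel A)%type.
Notation slate_int := (slate_int pi0 d0).
Notation cl p := (clip B (Rp p)).
Notation cl1 p z := (clip B (Rp p) z.1.1 z.1.2).
Notation cl2 p z := (clip B (Rp p) z.1.1 z.2).

Let bm p : bmeas (fun z : X * Borel A => cl p z.1 z.2).
Proof. exact: (bmeas_clip_pair pi0 _ B0 _ (Rp_bounded p)). Qed.
Let bm1 p : bmeas (fun z : slate => cl1 p z).
Proof. exact: (bmeas_clip1 pi0 _ B0 _ (Rp_bounded p)). Qed.
Let bm2 p : bmeas (fun z : slate => cl2 p z).
Proof. exact: (bmeas_clip2 pi0 _ B0 _ (Rp_bounded p)). Qed.

Definition kl_gap p q : R :=
  slate_int (fun z => kl (cl1 p z) (cl2 p z) (cl1 q z) (cl2 q z)).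

Lemma popL_sub p q :
  (popL d0 pi0 (Rp p) (Rp q) - popL d0 pi0 (Rp p) (Rp p) = (kl_gap p q)%:E)%E.
Proof.
pose ce q z := pref_avg B (Rp p) (fun z y => ell (cl1 q z) (cl2 q z) y) z.
have bce r : bmeas (ce r).
  apply: (bmeas_pref_avg pi0 _ B0 _ (Rp_bounded p)) => y; exact: bmeas_ell.
have popLE r : popL d0 pi0 (Rp p) (Rp r) = (slate_int (ce r))%:E.
  apply: slate_intE => // x a1 a2 s1 s2.
  by rewrite /ce /pref_avg /= !(clipE pi0) //; exact: Rp_bounded.
rewrite !popLE -EFinB -slate_intB; [|exact: bce..].
congr (slate_int _)%:E.
by apply/funext => z; rewrite /ce /pref_avg /kl; ring.
Qed.

Lemma kint_centered p x : kint pi0 (fun z : X * Borel A => cl p z.1 z.2) x = 0.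
Proof.
apply: EFin_inj; rewrite -kintE// -[RHS](Rp_centered p x).
apply: (eq_integral_conull _ _ (measurable_supp _ x) (supp_conull _ A_separable x)).
by move=> a sa; rewrite (clipE pi0)//; exact: Rp_bounded.
Qed.

(** The L1 distance under [d0] and [pi0], written on slates with an idle second arm for direct
    comparison with [kl_gap]. *)
Definition dist1 p q : R := slate_int (fun z => `|cl1 p z - cl1 q z|).

Lemma dist1_ge0 p q : 0 <= dist1 p q.
Proof.
rewrite -(slate_int_cst pi0 d0 0); apply: slate_int_le => //.
- exact: bmeas_cst.
- by apply: bmeas_norm; exact: bmeasB.
Qed.

Lemma dist1_lipschitz p q p' q' (e e' : R) :
  (forall x a, supp pi0 x a -> `|Rp p' x a - Rp p x a| <= e) ->
  (forall x a, supp pi0 x a -> `|Rp q' x a - Rp q x a| <= e') ->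
  dist1 p q <= dist1 p' q' + (e + e').
Proof.
move=> pe qe; rewrite -(slate_int_cst pi0 d0 (e + e')) -slate_intD; first last.
- exact: bmeas_cst.
- by apply: bmeas_norm; exact: bmeasB.
apply: slate_int_le => //.
- by apply: bmeas_norm; exact: bmeasB.
- by apply: bmeasD; [apply: bmeas_norm; exact: bmeasB|exact: bmeas_cst].
move=> x a1 a2 s1 _ /=; rewrite !(clipE pi0) //; try exact: Rp_bounded.
have -> : Rp p x a1 - Rp q x a1 = (Rp p' x a1 - Rp q' x a1) +
   (- (Rp p' x a1 - Rp p x a1) + (Rp q' x a1 - Rp q x a1)) by ring.
apply: (le_trans (ler_normD _ _)); rewrite lerD2l.
apply: (le_trans (ler_normD _ _)); rewrite normrN.
by apply: lerD; [exact: pe|exact: qe].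
Qed.

(* Centering makes the two arms uncorrelated, so that the squared difference of
   logit gaps dominates the squared deviation in the first arm alone. *)
Lemma kl_gap_ge p q : expR (- (8 * B)) / 64 * dist1 p q ^+ 2 <= kl_gap p q.
Proof.
have square_le (t : R) : t ^+ 2 <= 2 * t * t - t ^+ 2 by rewrite expr2; lra.
(* In place of Cauchy-Schwarz, [u ^+ 2] is minorized by its tangent [2 * t * |u| - t ^+ 2]. At
   [t = m], the mean of [|u|], this integrates to [m ^+ 2]. *)
have cross_le (t u v : R) :
    2 * t * `|u| - t ^+ 2 - 2 * (u * v) <= (u - v) ^+ 2.
  have := sqr_ge0 (`|u| - t); have := sqr_ge0 v.
  by rewrite !sqrrB real_normK ?num_real//; lra.
set k := expR _ / 64; have k0 : 0 <= k by rewrite divr_ge0// expR_ge0.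
set m := dist1 p q.
pose h (z : X * Borel A) := cl p z.1 z.2 - cl q z.1 z.2.
have bh : bmeas h by exact: bmeasB.
have bh1 : bmeas (fun z : slate => h z.1).
  by apply: (bmeas_comp (fun z : slate => z.1) h) => //; exact: measurable_fst.
have bh2 : bmeas (fun z : slate => h (z.1.1, z.2)).
  exact: (bmeas_comp _ h measurable_slate2).
have h0 x : kint pi0 h x = 0.
  have -> : h = fun z => cl p z.1 z.2 + -1 * cl q z.1 z.2.
    by apply/funext => z; rewrite mulN1r.
  by rewrite kintD ?kintZ ?kint_centered ?mulr0 ?addr0//; exact: bmeasZ.
have cross : slate_int (fun z => h z.1 * h (z.1.1, z.2)) = 0.
  by rewrite (slate_int_snd d0 pi0 h h 0)// mul0r.
have dm : slate_int (fun z : slate => `|h z.1|) = m by [].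
apply: (@le_trans _ _ (slate_int (fun z =>
    k * (2 * m * `|h z.1| - m ^+ 2 - 2 * (h z.1 * h (z.1.1, z.2)))))).
  have bn : bmeas (fun z : slate => `|h z.1|) by exact: bmeas_norm.
  have bc : bmeas (fun z : slate => h z.1 * h (z.1.1, z.2)) by exact: bmeasM.
  have b1 : bmeas (fun z : slate => 2 * m * `|h z.1|) by exact: bmeasZ.
  have b2 : bmeas (fun z : slate => 2 * (h z.1 * h (z.1.1, z.2))) by exact: bmeasZ.
  have b3 : bmeas (fun z : slate => 2 * m * `|h z.1| - m ^+ 2).
    by apply: bmeasB => //; exact: bmeas_cst.
  rewrite slate_intZ; last exact: bmeasB.
  rewrite (slate_intB _ _ _ _ b3 b2) (slate_intB _ _ _ _ b1 (bmeas_cst _)).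
  rewrite (slate_intZ _ _ _ _ bn) (slate_intZ _ _ _ _ bc) slate_int_cst//.
  rewrite cross.
  rewrite dm.
  rewrite mulr0 subr0.
  apply: ler_wpM2l; first exact: k0.
  exact: square_le.
apply: slate_int_le => //.
- apply: bmeasZ; apply: bmeasB; last by apply: bmeasZ; exact: bmeasM.
  by apply: bmeasB; [apply: bmeasZ; exact: bmeas_norm|exact: bmeas_cst].
- exact: bmeas_kl.
move=> x a1 a2 s1 s2; set z := (x, a1, a2).
have cB r y a : `|cl r y a| <= B by exact: clip_le.
apply: (le_trans _ (kl_ge B _ _ _ _ (cB p _ _) (cB p _ _) (cB q _ _) (cB q _ _))).
rewrite ler_wpM2l//.
have -> : cl1 p z - cl2 p z - (cl1 q z - cl2 q z) = h z.1 - h (z.1.1, z.2).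
  by rewrite /h /=; ring.
exact: cross_le.
Qed.

(** Almost sure equality of rewards says nothing at the selected actions, which may be [pi0]-null.
    Continuity extends it to the whole support, where the maximizer is unique. *)
Lemma dist1_eq0_same p q : dist1 p q = 0 -> same_sel p q.
Proof.
pose h (z : X * Borel A) := `|cl p z.1 z.2 - cl q z.1 z.2|.
have bh : bmeas h by apply: bmeas_norm; exact: bmeasB.
have -> : dist1 p q = \int[d0]_x kint pi0 h x by exact: (slate_int_fst d0 pi0 h).
have bk := bmeas_kint pi0 _ bh.
have k0 x : 0 <= kint pi0 h x by apply: Rintegral_ge0 => a _; exact: normr_ge0.
have hk := probability_bmeas_integrable d0 _ bk.
move=> int0.
have : (\int[d0]_x `|(kint pi0 h x)%:E| = 0)%E.
  rewrite -[RHS]/(0%:E) -int0 /Rintegral fineK; last exact: integrable_fin_num.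
  by apply: eq_integral => x _; rewrite gee0_abs// lee_fin.
move=> /(ae_eq_integral_abs d0 measurableT (f := fun x => (kint pi0 h x)%:E)) => -[].
  by apply/measurable_EFinP; case: bk.
move=> N [mN N0 kN].
have kae : {ae d0, forall x, kint pi0 h x = 0}.
  exists N; split => // x /= hx; apply: kN => /= H; apply: hx.
  by have [] := H I.
apply: filterS3 kae (filterI (Rp_cont p) (Rp_cont q)) (gap p) => x kx [cp cq] [hD _].
have heq : forall a, supp pi0 x a -> Rp p x a = Rp q x a.
  apply: (continuous_eq_supp pi0 x) => //; last exact: supp_conull.
  have bhx := bmeas_section h x bh.
  have : (\int[pi0 x]_a `|(h (x, a))%:E| = 0)%E.
    rewrite -[RHS]/(0%:E) -kx -kintE//.
    by apply: eq_integral => a _; rewrite gee0_abs// lee_fin /h normr_ge0.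
  move=> /(ae_eq_integral_abs (pi0 x) measurableT (f := fun a => (h (x, a))%:E)) => -[].
    by apply/measurable_EFinP; case: bhx.
  move=> N' [mN' N'0 hN']; exists N'; split => // a [sa pqa].
  apply: hN' => /= /(_ I) [] /eqP.
  rewrite /h normr_eq0 subr_eq0 /= !(clipE pi0) //; try exact: Rp_bounded.
  by move/eqP.
apply: contrapT => neq.
have sp : supp pi0 x (sel (Rp p) x) by apply: sel_supp; exact: admissible_Rp.
have sq : supp pi0 x (sel (Rp q) x) by apply: sel_supp; exact: admissible_Rp.
have := hD _ sq (nesym neq); rewrite (heq _ sp) (heq _ sq) ltNge.
by rewrite sel_max//; exact: admissible_Rp.
Qed.

(** Compactness is applied twice, in [q] for fixed [p] and then in [p]. It works because [same_sel]
    is locally constant and [dist1] is Lipschitz. *)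
Lemma dist1_uniform : exists2 rho : R, 0 < rho &
  forall p q, ~ same_sel p q -> rho <= dist1 p q.
Proof.
have halve (a a' c : R) : a <= a' + (0 + a / 2) -> c <= a / 2 -> c <= a' by lra.
have halve' (a a' a'' c : R) :
  a' <= a'' + (a / 2 + 0) -> a <= a' -> c <= a / 2 -> c <= a'' by lra.
have D20 : 0 < Dmin / 2 by rewrite divr_gt0.
have pos p q : ~ same_sel p q -> 0 < dist1 p q.
  move=> npq; rewrite lt_neqAle dist1_ge0 andbT eq_sym.
  by apply/negP => /eqP /dist1_eq0_same.
have near0 p (x : X) (a : A) : supp pi0 x a -> `|Rp p x a - Rp p x a| <= 0.
  by move=> _; rewrite subrr normr0.
have stage1 p : exists r : R, 0 < r /\ forall q, ~ same_sel p q -> r <= dist1 p q.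
  (* A centre with the selector of [p] forces that selector on its neighbours; around any other
     centre, half of its distance to [p] survives. *)
  pose rad q := if `[< same_sel p q >] then Dmin / 2 else dist1 p q / 2.
  have rad0 q : 0 < rad q.
    by rewrite /rad; case: ifPn => // /asboolPn npq; rewrite divr_gt0// pos.
  have [J fJ cJ] := sup_compact_cover pi0 _ _ rad Rp_compact rad0.
  have [e e0 eJ] := finite_set_pos_lbound _ _ (fun i => dist1 p i / 2) fJ.
  exists e; split => // q npq; have [i Ji] := cJ q; rewrite /rad.
  case: ifPn => [/asboolP pi /same_sel_near qi|/asboolPn npi qi].
    by case: npq; apply: same_sel_trans (same_sel_sym _ _ qi).
  have := dist1_lipschitz p i p q 0 (dist1 p i / 2) (near0 p)
    (fun x a sa => ltW (qi x a sa)).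
  move=> D; apply: (halve _ _ _ D); apply: eJ => //; rewrite divr_gt0//; exact: pos.
have [r rP] := choice stage1.
(* [Dmin / 2] preserves the selector of the centre, and [r p / 2] preserves half of its lower
   bound. *)
have rad0 p : 0 < Num.min (Dmin / 2) (r p / 2).
  by rewrite lt_min D20 divr_gt0//; case: (rP p).
have [J fJ cJ] := sup_compact_cover pi0 _ _ _ Rp_compact rad0.
have [e e0 eJ] := finite_set_pos_lbound _ _ (fun i => r i / 2) fJ.
exists e => // p q npq; have [i Ji pi] := cJ p.
have [ri0 ri] := rP i.
have pi1 : same_sel p i.
  by apply: same_sel_near => x a sa; have := pi x a sa; rewrite lt_min => /andP[].
have := ri q; have : ~ same_sel i q.
  by move=> iq; apply: npq; exact: same_sel_trans iq.
move=> + H => /H.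
have := dist1_lipschitz i q p q (r i / 2) 0 _ (near0 q).
have pi2 : forall x a, supp pi0 x a -> `|Rp p x a - Rp i x a| <= r i / 2.
  by move=> x a sa; have := pi x a sa; rewrite lt_min => /andP[_ /ltW].
move=> /(_ pi2) D rD; apply: (halve' (r i) (dist1 i q)) => //.
by apply: eJ => //; rewrite divr_gt0.
Qed.

Lemma kl_gap_uniform (eps0 : R) : 0 < eps0 ->
  exists2 gam0 : R, 0 < gam0 & forall p q,
    (eps0%:E <= subopt d0 sel (Rp p) (Rp q))%E -> gam0 <= kl_gap p q.
Proof.
move=> e0; have [rho rho0 rhoP] := dist1_uniform.
exists (expR (- (8 * B)) / 64 * rho ^+ 2) => [|p q epq].
  by rewrite mulr_gt0 ?exprn_gt0// divr_gt0// expR_gt0.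
have npq : ~ same_sel p q.
  by move=> /subopt_same pq; move: epq; rewrite pq lee_fin leNgt e0.
apply: le_trans (kl_gap_ge p q); rewrite ler_wpM2l ?divr_ge0 ?expR_ge0//.
by rewrite lerXn2r ?nnegrE ?dist1_ge0 ?(ltW rho0)//; exact: rhoP.
Qed.

Lemma covering_number_exists (e : R) : 0 < e ->
  exists N, covering_number pi0 (range Rp) e N.
Proof.
move=> e0.
pose Q n := exists2 C, size C = n & is_cover pi0 (range Rp) e C.
have exQ : exists n, `[< Q n >].
  have [J fJ cJ] := sup_compact_cover pi0 _ _ (fun=> e) Rp_compact (fun=> e0).
  have /finite_seqP[s Js] : finite_set (J : set {classic P}) by [].
  have inP (p : {classic P}) : p \in s -> List.In p s.
    elim: s {Js} => [//|p' s IH]; rewrite inE => /predU1P[->|/IH]; first by left.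
    by right.
  exists (size (map Rp s)); apply/asboolP; exists (map Rp s) => //; split.
    by move=> c /List.in_map_iff[p [<- _]]; exists p.
  move=> _ [q _ <-]; have [p Jp qp] := cJ q.
  exists (Rp p).
    by apply: List.in_map; apply: inP; move: Jp; rewrite Js.
  by apply/supnorm_leP => x a sa; exact/ltW/qp.
have [N /asboolP QN minN] := ex_minnP exQ.
by exists N; split => // C CC; apply: minN; apply/asboolP; exists C.
Qed.

Lemma kl_gap_lipschitz p q i (r : R) :
  (forall x a, supp pi0 x a -> `|Rp q x a - Rp i x a| <= r) ->
  kl_gap p q <= kl_gap p i + 2 * r.
Proof.
move=> qi; rewrite -(slate_int_cst pi0 d0 (2 * r)) -slate_intD; first last.
- exact: bmeas_cst.
- exact: bmeas_kl.
apply: slate_int_le => //.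
- exact: bmeas_kl.
- by apply: bmeasD; [exact: bmeas_kl|exact: bmeas_cst].
move=> x a1 a2 s1 s2 /=; rewrite !(clipE pi0) //; try exact: Rp_bounded.
have h y := ell_lipschitz _ _ _ _ _ y (qi _ _ s1) (qi _ _ s2).
have {}h y : ell (Rp q x a1) (Rp q x a2) y <=
    ell (Rp i x a1) (Rp i x a2) y + 2 * r.
  by have := h y; rewrite ler_norml => /andP[_]; rewrite lerBlDl.
rewrite /kl; set p1 := pref _ _ true; set p2 := pref _ _ false.
have -> : 2 * r = p1 * (2 * r) + p2 * (2 * r) by rewrite -mulrDl pref_sum mul1r.
rewrite addrACA -!mulrDr.
have p10 : 0 <= p1 by exact/ltW/pref_gt0.
have p20 : 0 <= p2 by exact/ltW/pref_gt0.
by apply: lerD; apply: ler_wpM2l => //; rewrite [leRHS]addrAC lerD2r.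
Qed.

(** Yields [gam <= M] below, which [round_mean_expR_le] requires to keep [l * M] at most 1/4. *)
Lemma kl_gap_le p q : kl_gap p q <= ln 2 + 2 * B.
Proof.
rewrite -(slate_int_cst pi0 d0 (ln 2 + 2 * B)); apply: slate_int_le => //.
- exact: bmeas_kl.
- exact: bmeas_cst.
move=> x a1 a2 s1 s2; set z := (x, a1, a2).
have cB r y a : `|cl r y a| <= B by exact: clip_le.
have h y : ell (cl1 q z) (cl2 q z) y - ell (cl1 p z) (cl2 p z) y <= ln 2 + 2 * B.
  rewrite lerBlDr (le_trans (ell_le B _ _ y (cB _ _ _) (cB _ _ _)))//.
  by rewrite lerDl ell_ge0.
rewrite /kl; set p1 := pref _ _ true; set p2 := pref _ _ false.
have -> : ln 2 + 2 * B = p1 * (ln 2 + 2 * B) + p2 * (ln 2 + 2 * B).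
  by rewrite -mulrDl pref_sum mul1r.
have p10 : 0 <= p1 by exact/ltW/pref_gt0.
have p20 : 0 <= p2 by exact/ltW/pref_gt0.
by apply: lerD; exact: ler_wpM2l.
Qed.

Lemma Dmax_real : exists K : R,
  [/\ ereal_sup [set (Rp z.1.1 z.1.2 (sel (Rp z.1.1) z.1.2) - Rp z.1.1 z.1.2 z.2)%:E
        | z in [set z : P * X * A | supp pi0 z.1.2 z.2]] = K%:E,
      0 <= K &
      forall p x a, supp pi0 x a -> Rp p x (sel (Rp p) x) - Rp p x a <= K].
Proof.
set S := [set _ | _ in _].
have le_sup p x a : supp pi0 x a ->
    ((Rp p x (sel (Rp p) x) - Rp p x a)%:E <= ereal_sup S)%E.
  by move=> sa; apply: ereal_sup_ubound; exists (p, x, a).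
have [p0 _] := truth_exists.
have [a0 sa0] := supp_nonempty pi0 A_separable point.
have sup0 : (0 <= ereal_sup S)%E.
  apply: le_trans (le_sup p0 _ _ sa0); rewrite lee_fin subr_ge0.
  by apply: sel_max => //; exact: admissible_Rp.
have sup2B : (ereal_sup S <= (2 * B)%:E)%E.
  apply: ge_ereal_sup => _ [[[p x] a] /= sa <-]; rewrite lee_fin.
  have ss : supp pi0 x (sel (Rp p) x) by apply: sel_supp; exact: admissible_Rp.
  have [_ bp] := Rp_bounded p; have := bp _ _ sa; have := bp _ _ ss.
  by rewrite !ler_norml => /andP[? ?] /andP[? ?]; lra.
have fin : ereal_sup S \is a fin_num.
  by rewrite ge0_fin_numE// (le_lt_trans sup2B)// ltry.
exists (fine (ereal_sup S)); split; first by rewrite fineK.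
  exact: fine_ge0.
by move=> p x a sa; rewrite -lee_fin fineK//; exact: le_sup.
Qed.

Lemma ler_sum_In (I : Type) (L : seq I) (F : I -> R) i :
  (forall j, 0 <= F j) -> List.In i L -> F i <= \sum_(j <- L) F j.
Proof.
move=> F0; elim: L => [//|j L IH] [->|/IH iL]; rewrite big_cons.
  by rewrite lerDl sumr_ge0.
by rewrite (le_trans iL)// lerDr.
Qed.

(** * Regret of the online iterates *)

Variable eta : R.
Hypothesis eta_gt0 : 0 < eta.
Variable rhat : nat -> Omega X A -> @reward R d X A.
Hypothesis rhat0 : forall w, rhat 0 w = @zero_reward R d X A.
Hypothesis rhatF : forall t w, (0 < t)%N -> exists q, rhat t w = Rp q.
Hypothesis rhat_min : forall t w, (0 < t)%N -> forall q,
  dpo_loss pi0 eta t w (rhat t w) <= dpo_loss pi0 eta t w (Rp q).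

Lemma rhat_admissible t w : admissible (rhat t w).
Proof.
by case: t => [|t]; [left|right; exact: rhatF].
Qed.

Let rhat_bounded t w : bounded_reward pi0 B (rhat t w).
Proof. by apply: admissible_bounded; exact: rhat_admissible. Qed.

Notation round_regret p t :=
  (expect d0 pi0 eta (Rp p) rhat t (fun w => subopt d0 sel (Rp p) (rhat t w))).

Let round_mean_cst p f (c : R) : bounded_reward pi0 B f ->
  round_mean d0 pi0 B eta (Rp p) f (fun _ _ => c) = c.
Proof.
move=> bf; rewrite /round_mean -[RHS]mulr1.
rewrite -(slate_int_density d0 pi0 A_separable B eta B0 eta_gt0 f bf).
rewrite -slate_intZ; last exact: bmeas_density2.
congr (slate_int _); apply/funext => z.
by rewrite /pref_avg -mulrDl pref_sum mul1r mulrC.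
Qed.

(** Serves round 0, where the zero reward escapes the dichotomy, and the early rounds, where the
    exponential bound is not yet informative. *)
Lemma round_regret_le p t (K : R) :
  0 <= K -> (forall x a, supp pi0 x a -> Rp p x (sel (Rp p) x) - Rp p x a <= K) ->
  (round_regret p t <= K%:E)%E.
Proof.
move=> K0 HK; apply: (le_trans (expect_le_sum d0 pi0 A_separable B eta B0 eta_gt0
  (Rp p) (Rp_bounded p) rhat rhat_bounded t _ unit [:: tt] (fun _ _ _ => 1) K 1
  K0 ler01 _ _ _ _ _)) => //.
- by move=> _ _; exact: bmeas_cst.
- by move=> _ s w; rewrite round_mean_cst.
- by move=> w; apply: subopt_ge0; exact: rhat_admissible.
- move=> w _; rewrite big_seq1 big1// mulr1.
  by apply: subopt_le => //; exact: rhat_admissible.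
by rewrite expr1n !mulr1 lexx.
Qed.

Section concentration.
Variables (p : P) (eps0 gam0 : R).
Hypothesis gam0_gt0 : 0 < gam0.
Hypothesis dichotomy : forall q, subopt d0 sel (Rp p) (Rp q) = 0%E \/
  (eps0%:E <= subopt d0 sel (Rp p) (Rp q))%E.
Hypothesis identify : forall q, (eps0%:E <= subopt d0 sel (Rp p) (Rp q))%E ->
  gam0 <= kl_gap p q.
Let M : R := ln 2 + 2 * B.
Let gam : R := expR (2 * eta * B) ^- 2 * gam0.
Let l : R := gam / (4 * M ^+ 2).

Let c : R := gam ^+ 2 / (128 * M ^+ 2).

(* Cover elements that can stand for a policy with positive regret. *)
Let active (f : @reward R d X A) := exists i q, [/\ f = Rp i,
  (eps0%:E <= subopt d0 sel (Rp p) (Rp q))%E &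
  (supnorm pi0 (rdiff (Rp q) f) <= (gam / 32)%:E)%E].

Let excess f (z : slate) y : R :=
  ell (clip B f z.1.1 z.1.2) (clip B f z.1.1 z.2) y - ell (cl1 p z) (cl2 p z) y.

(** The union bound asks the same rate of every cover element; inactive ones, whose drift is not
    controlled, get weight 0. *)
Let weight f (z : slate) y : R :=
  if `[< active f >] then expR (- (l * (excess f z y - gam / 16))) else 0.

Let M_gt0 : 0 < M.
Proof. by rewrite ltr_pwDl ?mulr_ge0// ln_gt0// ltr1n. Qed.

Let gam_gt0 : 0 < gam.
Proof. by rewrite mulr_gt0// invr_gt0 exprn_gt0// expR_gt0. Qed.

Let l_ge0 : 0 <= l.
Proof. by rewrite divr_ge0 ?(ltW gam_gt0)// mulr_ge0// sqr_ge0. Qed.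

Let beta2_le1 : expR (2 * eta * B) ^- 2 <= 1.
Proof.
rewrite invf_le1 ?exprn_gt0 ?expR_gt0// exprn_ege1//.
by rewrite (le_trans _ (expR_ge1Dx _))// lerDl !mulr_ge0// (ltW eta_gt0).
Qed.

Let round_mean_weight t w f :
  round_mean d0 pi0 B eta (Rp p) (rhat t w) (weight f)
    <= expR (- (gam ^+ 2 / (128 * M ^+ 2))).
Proof.
rewrite /weight; case: asboolP => [[i [q [-> epq /supnorm_leP qi]]]|_]; last first.
  by rewrite round_mean_cst// expR_ge0.
have drift_le (a b : R) : b <= a / 16 -> 15 / 16 * a <= a - b by lra.
have gap_q := identify _ epq.
have gap_i : gam0 - gam / 16 <= kl_gap p i.
  have := kl_gap_lipschitz p q i _ qi.
  have -> : 2 * (gam / 32) = gam / 16 by field.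
  by rewrite -lerBlDr; apply: le_trans; rewrite lerD2r.
apply: (round_mean_expR_le d0 pi0 A_separable B eta B0 eta_gt0 (Rp p)
  (Rp_bounded p) _ (Rp i) gam) => //.
- exact: Rp_bounded.
- apply/andP; split; first exact: (ltW gam_gt0).
  apply: (le_trans _ (kl_gap_le p q)); apply: (le_trans _ gap_q).
  by apply: ler_piMl; [exact: ltW|exact: beta2_le1].
(* As [beta ^- 2 <= 1], the covering error may be charged in full, leaving [15 / 16] of [gam]. *)
apply: (@le_trans _ _ (expR (2 * eta * B) ^- 2 * (gam0 - gam / 16))).
  rewrite mulrBr -/gam.
  have : expR (2 * eta * B) ^- 2 * (gam / 16) <= gam / 16.
    by apply: ler_piMl; [rewrite divr_ge0// (ltW gam_gt0)|exact: beta2_le1].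
  exact: drift_le.
by rewrite ler_wpM2l// invr_ge0 exprn_ge0// expR_ge0.
Qed.

Let weight_ge0 f z y : 0 <= weight f z y.
Proof. by rewrite /weight; case: ifP => // _; exact: expR_ge0. Qed.

Let bmeas_weight f y : bmeas (weight f ^~ y).
Proof.
rewrite /weight; case: asboolP => [[i [q [-> _ _]]]|_]; last exact: bmeas_cst.
apply: bmeas_expR; apply: bmeasN; apply: bmeasZ; apply: bmeasB.
  by apply: bmeasB; exact: bmeas_ell.
exact: bmeas_cst.
Qed.

(** When the regret is positive, a cover element close to the minimizer is active and its cumulative
    excess loss is at most [t * gam / 16], so its weights multiply to at least 1. The regret is thus
    at most [K] times the sum of the products. *)
Lemma round_regret_exp_le t (C : seq (@reward R d X A)) (K : R) :
  (0 < t)%N -> is_cover pi0 (range Rp) (gam / 32) C ->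
  0 <= K -> (forall x a, supp pi0 x a -> Rp p x (sel (Rp p) x) - Rp p x a <= K) ->
  (round_regret p t <=
    (K * ((size C)%:R * expR (- (gam ^+ 2 / (128 * M ^+ 2))) ^+ t))%:E)%E.
Proof.
move=> t0 [CF coverC] K0 HK.
apply: (expect_le_sum d0 pi0 A_separable B eta B0 eta_gt0
  (Rp p) (Rp_bounded p) rhat rhat_bounded t _ _ C weight K _
  K0 (expR_ge0 _)) => //.
  by move=> w; apply: subopt_ge0; exact: rhat_admissible.
move=> w ws.
have sum0 : 0 <= \sum_(i <- C) \prod_(s < t) weight i (w s).1 (w s).2.
  by apply: sumr_ge0 => i _; exact: prodr_ge0.
have [q rq] := rhatF t w t0.
have [s0|epq] := dichotomy q; first by rewrite rq s0 lee_fin mulr_ge0.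
apply: (@le_trans _ _ (K * 1)%:E).
  by rewrite mulr1; apply: subopt_le => //; exact: rhat_admissible.
rewrite lee_fin ler_wpM2l//.
have [f Cf qf] := coverC (Rp q) (ex_intro2 _ _ q I erefl).
apply: le_trans (ler_sum_In _ C _ f _ Cf); last by move=> j; exact: prodr_ge0.
have [i _ fi] := CF _ Cf.
have af : `[< active f >] by apply/asboolP; exists i, q.
rewrite (eq_bigr (fun s : 'I_t => expR (- (l * (excess f (w s).1 (w s).2 - gam / 16))))).
  rewrite -expR_sum; apply: (le_trans _ (expR_ge1Dx _)).
  rewrite lerDl sumrN oppr_ge0 -mulr_sumr.
  rewrite mulr_ge0_le0//.
  apply: (@le_trans _ _ (\sum_(s < t)
      (ell (Rp q (st_x (w s)) (st_a1 (w s))) (Rp q (st_x (w s)) (st_a2 (w s)))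
         (st_y (w s)) -
       ell (Rp p (st_x (w s)) (st_a1 (w s))) (Rp p (st_x (w s)) (st_a2 (w s)))
         (st_y (w s))))).
    apply: ler_sum => s _; have [s1 s2] := ws s (ltn_ord s).
    rewrite /excess -!/(st_x _) -!/(st_a1 _) -!/(st_a2 _) -!/(st_y _) -fi.
    rewrite !(clipE pi0) //; try exact: Rp_bounded.
    move/supnorm_leP : qf; rewrite -fi /rdiff => qi.
    have := ell_lipschitz _ _ _ _ _ (st_y (w s)) (qi _ _ s1) (qi _ _ s2).
    have -> : 2 * (gam / 32) = gam / 16 by field.
    rewrite ler_norml lerNl => /andP[+ _].
    by rewrite opprB => h; rewrite addrAC lerD2r lerBlDr -lerBlDl.
  (* The truth is itself a competitor in the class, so the empirical excess loss of the minimizer is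
     nonpositive. *)
  have := rhat_min _ w t0 p; rewrite rq.
  rewrite !(dpo_lossE pi0 A_separable B eta B0 eta_gt0) //; try exact: Rp_bounded.
  rewrite ler_pM2l ?invr_gt0 ?ltr0n// => qp.
  by rewrite [leLHS]sumrB subr_le0.
by move=> s _; rewrite /weight af.
Qed.

Lemma regret_le T N (K : R) :
  covering_number pi0 (range Rp) (gam / 32) N ->
  0 <= K -> (forall x a, supp pi0 x a -> Rp p x (sel (Rp p) x) - Rp p x a <= K) ->
  (\sum_(t < T) round_regret p t <=
   (K * (1 + (Num.ceil (c^-1 * ln (2 * N%:R)))%:~R + (expR c - 1)^-1))%:E)%E.
Proof.
move=> [[C CN cover] _] K0 HK.
have N0 : (0 < N)%N.
  rewrite -CN; case: C cover {CN} => [[_ /(_ (Rp p))]|//].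
  by case=> //; exists p.
have c0 : 0 < c by rewrite divr_gt0 ?exprn_gt0// mulr_gt0// exprn_gt0.
have N2 : 1 <= 2 * N%:R :> R by rewrite -natrM ler1n muln_gt0.
set k := Num.ceil _.
have k0 : 0 <= k.
  rewrite -(ceil0 R); apply: le_ceil; rewrite mulr_ge0 ?invr_ge0 ?(ltW c0)//.
  exact: ln_ge0.
have -> : k%:~R = `|k|%N%:R :> R by rewrite natr_absz ger0_norm.
have N2k : 2 * N%:R <= expR (c * `|k|%N%:R).
  rewrite -[leLHS]lnK ?posrE ?(lt_le_trans ltr01 N2)// ler_expR.
  rewrite natr_absz ger0_norm// -ler_pdivrMl//.
  exact: ceil_ge.
apply: (@le_trans _ _ (K * \sum_(t < T)
    Num.min 1 (2 * N%:R * expR (- (c * t%:R))))%:E); last first.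
  by rewrite lee_fin ler_wpM2l// sum_min1_geometric_le.
rewrite mulr_sumr -sumEFin; apply: lee_sum => t _.
rewrite minEle; case: ifPn => [_|].
  by rewrite mulr1; exact: round_regret_le.
(* At [t = 0] the minimum is 1 because [1 <= 2 * N], so this branch has [t > 0] and the iterate
   belongs to the class. *)
case: (posnP t) => [->|t0 _]; first by rewrite mulr0 oppr0 expR0 mulr1 N2.
apply: (le_trans (round_regret_exp_le _ _ _ t0 cover K0 HK)).
(* The one-sided Chernoff bound gives [N], within the claimed [2 * N]. *)
rewrite lee_fin ler_wpM2l// CN -expRM_natr -/c mulNr ler_wpM2r ?expR_ge0//.
by rewrite ler_peMl// ler1n.
Qed.

End concentration.

End truths.

Theorem theorem2
  (R : realType) (d : measure_display) (X : measurableType d)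
  (A : pseudoPMetricType R)
  (HA_metric : hausdorff_space A)
  (HA_sep : exists2 D : set A, countable D & closure D = setT)
  (d0 : probability X R) (pi0 : R.-pker X ~> Borel A)
  (P : Type) (Rp : P -> @reward R d X A)
  (HRmeas : forall p, measurable_fun setT (fun z : X * Borel A => Rp p z.1 z.2))
  (Hcentered : forall p x, (\int[pi0 x]_a (Rp p x a)%:E = 0)%E)
  (sel : @reward R d X A -> X -> A)
  (Hsel : forall Rw : @reward R d X A,
     (Rw = @zero_reward R d X A \/ exists p, Rw = Rp p) ->
     measurable_fun setT (sel Rw : X -> Borel A) /\ argmax_sel pi0 Rw (sel Rw))
  (HC1_compact : sup_compact pi0 (range Rp))
  (HC1_cont : forall p, {ae d0, forall x, {within supp pi0 x, continuous (Rp p x)}})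
  (Dmin : R) (HDmin : 0 < Dmin)
  (HC2 : forall p, {ae d0, forall x,
     (forall a, supp pi0 x a -> a <> sel (Rp p) x -> Rp p x a < Rp p x (sel (Rp p) x))
     /\ (Dmin%:E <= (Rp p x (sel (Rp p) x))%:E
          - ereal_sup [set (Rp p x a)%:E |
                       a in [set a | supp pi0 x a /\ a <> sel (Rp p) x]])%E})
  (eta : R) (Heta : 0 < eta)
  (B : R) (HB : ereal_sup [set supnorm pi0 f | f in range Rp] = B%:E)
  (rhat : nat -> Omega X A -> @reward R d X A)
  (Hrhat0 : forall w, rhat 0 w = @zero_reward R d X A)
  (HrhatF : forall t w, (0 < t)%N -> exists q, rhat t w = Rp q)
  (HrhatMin : forall t w, (0 < t)%N -> forall q,
     dpo_loss pi0 eta t w (rhat t w) <= dpo_loss pi0 eta t w (Rp q))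
  (HrhatAdapted : forall t (w w' : Omega X A),
     (forall s, (s < t)%N -> w s = w' s) -> rhat t w = rhat t w')
  (HrhatMeas : forall t,
     measurable_fun setT (fun z : Omega X A * X * Borel A => rhat t z.1.1 z.1.2 z.2)) :
  let G p Rw := subopt d0 sel (Rp p) Rw in
  let L p Rw := popL d0 pi0 (Rp p) Rw in
  let Dmax := ereal_sup
    [set (Rp z.1.1 z.1.2 (sel (Rp z.1.1) z.1.2) - Rp z.1.1 z.1.2 z.2)%:E
    | z in [set z : P * X * A | supp pi0 z.1.2 z.2]] in
  let regret p T := (\sum_(t < T)
     expect d0 pi0 eta (Rp p) rhat t (fun w => G p (rhat t w)))%E in
  let S := [set regret z.1 z.2 | z in [set z : P * nat | (1 <= z.2)%N]] in
  [/\ exists2 eps0 : R, 0 < eps0 &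
        forall p q, G p (Rp q) = 0%E \/ (eps0%:E <= G p (Rp q))%E,
      forall eps0 : R, 0 < eps0 ->
        (forall p q, G p (Rp q) = 0%E \/ (eps0%:E <= G p (Rp q))%E) ->
        exists2 gam0 : R, 0 < gam0 &
          forall p q, (eps0%:E <= G p (Rp q))%E ->
            (gam0%:E <= L p (Rp q) - L p (Rp p))%E,
      (ereal_sup S < +oo)%E &
      forall (eps0 gam0 : R) (N : nat), 0 < eps0 ->
        (forall p q, G p (Rp q) = 0%E \/ (eps0%:E <= G p (Rp q))%E) ->
        0 < gam0 ->
        (forall p q, (eps0%:E <= G p (Rp q))%E ->
            (gam0%:E <= L p (Rp q) - L p (Rp p))%E) ->
        let beta := expR (2 * eta * B) in
        let gam := beta ^- 2 * gam0 in
        let c := gam ^+ 2 / (128 * (ln 2 + 2 * B) ^+ 2) in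
        covering_number pi0 (range Rp) (gam / 32) N ->
        (ereal_sup S <= Dmax *
           (1 + (Num.ceil (c^-1 * ln (2 * N%:R)))%:~R + (expR c - 1)^-1)%:E)%E].
Proof.
move=> G L Dmax regret S.
have [K [DK K0 HK]] := Dmax_real HA_sep pi0 P Rp HRmeas sel Hsel B HB.
have gapE := popL_sub HA_sep d0 pi0 P Rp HRmeas B HB.
have bound (eps0 gam0 : R) (N : nat) : 0 < eps0 ->
  (forall p q, G p (Rp q) = 0%E \/ (eps0%:E <= G p (Rp q))%E) ->
  0 < gam0 ->
  (forall p q, (eps0%:E <= G p (Rp q))%E -> (gam0%:E <= L p (Rp q) - L p (Rp p))%E) ->
  let gam := expR (2 * eta * B) ^- 2 * gam0 in
  let c := gam ^+ 2 / (128 * (ln 2 + 2 * B) ^+ 2) in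
  covering_number pi0 (range Rp) (gam / 32) N ->
  (ereal_sup S <=
    (K * (1 + (Num.ceil (c^-1 * ln (2 * N%:R)))%:~R + (expR c - 1)^-1))%:E)%E.
  move=> e0 dich g0 ident gam c covN.
  apply: ge_ereal_sup => _ [[p T] _ <-].
  apply: (regret_le HA_sep d0 pi0 P Rp HRmeas sel Hsel B HB eta Heta rhat Hrhat0
    HrhatF HrhatMin p eps0 gam0 g0 (dich p) _ T N K covN K0 (HK p)) => q epq.
  by rewrite -lee_fin -gapE; exact: ident.
have dich := subopt_dichotomy d0 pi0 P Rp HRmeas sel Hsel HC1_compact
  Dmin HDmin HC2.
have ident (eps0 : R) : 0 < eps0 -> exists2 gam0 : R, 0 < gam0 &
    forall p q, (eps0%:E <= G p (Rp q))%E -> (gam0%:E <= L p (Rp q) - L p (Rp p))%E.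
  move=> e0; have [gam0 g0 gP] := kl_gap_uniform HA_sep d0 pi0 P Rp HRmeas Hcentered
    sel Hsel HC1_compact HC1_cont Dmin HDmin HC2 B HB eps0 e0.
  by exists gam0 => // p q epq; rewrite /L gapE lee_fin; exact: gP.
split.
- exact: dich.
- by move=> eps0 e0 _; exact: ident.
- have [eps0 e0 eP] := dich; have [gam0 g0 gP] := ident _ e0.
  have gam_gt0 : 0 < expR (2 * eta * B) ^- 2 * gam0 / 32.
    by rewrite divr_gt0// mulr_gt0// invr_gt0 exprn_gt0// expR_gt0.
  have [N covN] := covering_number_exists pi0 P Rp HC1_compact _ gam_gt0.
  by apply: le_lt_trans (bound eps0 gam0 N e0 eP g0 gP covN) _; rewrite ltry.
move=> eps0 gam0 N e0 eP g0 gP beta gam c covN.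
by rewrite /Dmax DK -EFinM; exact: bound eP g0 gP covN.
Qed.
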